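(* For every finite poset $\mathcal{Q}$, \[ n_\mathcal{Q}:=\sup_{\mathcal{T}\text{ finite total order}}\operatorname{gldim}_{\mathrm{spread}}(\mathcal{T}\times\mathcal{Q})<\infty. \] Moreover, if $\mathcal{G}$ is a finite grid poset, then $n_\mathcal{G}=\operatorname{gldim}_{\mathrm{spread}}([k]\times\mathcal{G})$ where $k=1+4|\mathcal{G}|$.
   Context: Fix a field $\mathbb{k}$. $[k]$ denotes the total order $\{0<1<\dots<k-1\}$; products of posets carry the product order. For a finite poset $\mathcal{P}$, $\operatorname{rep}\mathcal{P}$ is the category of functors $\mathcal{P}\to\mathrm{vec}_\mathbb{k}$ (finite-dimensional vector spaces). A spread of $\mathcal{P}$ is a nonempty subset $S$ that is convex ($s\le p\le s'$ with $s,s'\in S$ implies $p\in S$) and connected (any two elements joined by a zigzag of comparable elements in $S$); its spread representation $\mathbb{k}_S$ is $\mathbb{k}$ on $S$, $0$ elsewhere, with identity maps inside $S$. Let $\operatorname{add}\operatorname{spread}(\mathcal{P})$ be the finite direct sums of spread representations (and their summands). A spread-approximation of $M$ is $f:C\to M$ with $C\in\operatorname{add}\operatorname{spread}(\mathcal{P})$ and $\operatorname{Hom}(Z,f)$ surjective for all $Z\in \operatorname{add}\operatorname{spread}(\mathcal{P})$; a spread-resolution is $\cdots\to C_1\xrightarrow{f_1}C_0\xrightarrow{f_0}M\to 0$ with each induced $C_i\to\ker f_{i-1}$ a spread-approximation ($f_{-1}:M\to0$); its length is the least $i$ with $C_{i+1}=0$. The spread-dimension of $M$ is the minimal length of a spread-resolution,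 and $\operatorname{gldim}_{\mathrm{spread}}(\mathcal{P})$ is the supremum of spread-dimensions over all $M\in\operatorname{rep}\mathcal{P}$. A finite grid poset is a finite product of finite total orders. *)

(* Defs.v *)
From HB Require Import structures.
From mathcomp Require Import all_boot all_order all_algebra.
Export Order.DefaultProdOrder.

Set Implicit Arguments.
Unset Strict Implicit.
Unset Printing Implicit Defensive.

Import Order.TTheory GRing.Theory.
Local Open Scope ring_scope.
Local Open Scope order_scope.

(* A representation of a poset T over K (data part): a finite dimension
   rdim x for every x and, for every pair (x,y), a matrix rmap x y acting on
   row vectors (v |-> v *m rmap x y) from K^(rdim x) to K^(rdim y).
   Only the maps for x <= y are meaningful. *)
Record rep (K : fieldType) (T : Type) := Rep {
  rdim : T -> nat;
  rmap : forall x y : T, 'M[K]_(rdim x, rdim y) }.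

Definition is_rep (K : fieldType) (disp : Order.disp_t) (T : porderType disp)
    (M : rep K T) : Prop :=
  (forall x : T, rmap M x x = 1%:M) /\
  (forall x y z : T, x <= y -> y <= z -> rmap M x z = rmap M x y *m rmap M y z).

Definition homf (K : fieldType) (T : Type) (M N : rep K T) :=
  forall x : T, 'M[K]_(rdim M x, rdim N x).

Definition natural (K : fieldType) (disp : Order.disp_t) (T : porderType disp)
    (M N : rep K T) (f : homf M N) : Prop :=
  forall x y : T, x <= y -> rmap M x y *m f y = f x *m rmap N x y.

Definition compf (K : fieldType) (T : Type) (L M N : rep K T)
    (f : homf L M) (g : homf M N) : homf L N := fun x => f x *m g x.

Definition zerof (K : fieldType) (T : Type) (M N : rep K T) (f : homf M N) : Prop :=
  forall x : T, f x = 0.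

Definition zero_rep (K : fieldType) (T : Type) : rep K T :=
  @Rep K T (fun _ => 0%N) (fun _ _ => 0).

Definition is_zero_rep (K : fieldType) (T : Type) (M : rep K T) : Prop :=
  forall x : T, rdim M x = 0%N.

Definition dsum (K : fieldType) (T : Type) (M N : rep K T) : rep K T :=
  @Rep K T (fun x => (rdim M x + rdim N x)%N)
    (fun x y => block_mx (rmap M x y) 0 0 (rmap N x y)).

Definition bigdsum (K : fieldType) (T : Type) (s : seq (rep K T)) : rep K T :=
  foldr (@dsum K T) (zero_rep K T) s.

Definition convex (disp : Order.disp_t) (T : finPOrderType disp) (S : {set T}) : Prop :=
  forall s p s' : T, s \in S -> s' \in S -> s <= p -> p <= s' -> p \in S.

Definition spread_rel (disp : Order.disp_t) (T : finPOrderType disp) (S : {set T}) : rel T :=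
  fun x y => [&& x \in S, y \in S & (x <= y) || (y <= x)].

Definition connected_set (disp : Order.disp_t) (T : finPOrderType disp) (S : {set T}) : Prop :=
  forall x y : T, x \in S -> y \in S -> connect (spread_rel S) x y.

Definition is_spread (disp : Order.disp_t) (T : finPOrderType disp) (S : {set T}) : Prop :=
  S != set0 /\ convex S /\ connected_set S.

(* The spread representation k_S: k on S, 0 elsewhere, identities inside S. *)
Definition spread_rep (K : fieldType) (T : finType) (S : {set T}) : rep K T :=
  @Rep K T (fun x => nat_of_bool (x \in S)) (fun x y => const_mx 1).

Definition in_add_spread (K : fieldType) (disp : Order.disp_t) (T : finPOrderType disp)
    (Z : rep K T) : Prop :=
  is_rep Z /\
  exists Ss : seq {set T}, (forall S0, S0 \in Ss -> is_spread S0) /\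
  exists (s : homf Z (bigdsum [seq spread_rep K S0 | S0 <- Ss]))
         (r : homf (bigdsum [seq spread_rep K S0 | S0 <- Ss]) Z),
    natural s /\ natural r /\ (forall x, s x *m r x = 1%:M).

(* A spread-resolution of M:
     ... -> C (i+2) --d (i+1)--> C (i+1) --d i--> C i -> ... -> C 0 --e--> M -> 0
   (so d i is f_{i+1} and e is f_0 in the paper's notation), each C i in
   add spread, the composites are zero (so C i maps into ker f_{i-1}), and each
   induced map C i -> ker f_{i-1} is a spread-approximation, i.e. every
   morphism from some Z in add spread into ker f_{i-1} (= a morphism into the
   codomain killed by f_{i-1}) factors through C i. *)
Record spread_resolution (K : fieldType) (disp : Order.disp_t) (T : finPOrderType disp)
    (M : rep K T) := SpreadRes {
  sr_C : nat -> rep K T;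
  sr_e : homf (sr_C 0) M;
  sr_d : forall i : nat, homf (sr_C i.+1) (sr_C i) }.

Definition is_spread_resolution (K : fieldType) (disp : Order.disp_t)
    (T : finPOrderType disp) (M : rep K T) (R : spread_resolution M) : Prop :=
  let C := sr_C R in let e := sr_e R in let d := sr_d R in
  (forall i, in_add_spread (C i)) /\
  natural e /\ (forall i, natural (d i)) /\
  zerof (compf (d 0) e) /\ (forall i, zerof (compf (d i.+1) (d i))) /\
  (forall (Z : rep K T) (g : homf Z M), in_add_spread Z -> natural g ->
     exists h : homf Z (C 0), natural h /\ forall x, compf h e x = g x) /\
  (forall (Z : rep K T) (g : homf Z (C 0)), in_add_spread Z -> natural g ->
     zerof (compf g e) ->
     exists h : homf Z (C 1), natural h /\ forall x, compf h (d 0) x = g x) /\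
  (forall i (Z : rep K T) (g : homf Z (C i.+1)), in_add_spread Z -> natural g ->
     zerof (compf g (d i)) ->
     exists h : homf Z (C i.+2), natural h /\ forall x, compf h (d i.+1) x = g x).

Definition spread_dim_le (K : fieldType) (disp : Order.disp_t) (T : finPOrderType disp)
    (M : rep K T) (n : nat) : Prop :=
  exists R : spread_resolution M, is_spread_resolution R /\
    exists i : nat, (i <= n)%N /\ is_zero_rep (sr_C R i.+1).

Definition gldim_spread_le (K : fieldType) (disp : Order.disp_t) (T : finPOrderType disp)
    (n : nat) : Prop :=
  forall M : rep K T, is_rep M -> spread_dim_le M n.

Definition is_grid (disp : Order.disp_t) (G : finPOrderType disp) : Prop :=
  exists (m : nat) (ks : 'I_m -> nat) (phi : G -> {ffun 'I_m -> nat}),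
    injective phi /\
    (forall x i, (phi x i < ks i)%N) /\
    (forall v : {ffun 'I_m -> nat}, (forall i, (v i < ks i)%N) -> exists x, phi x = v) /\
    (forall x y : G, (x <= y) = [forall i, (phi x i <= phi y i)%N]).

(* Main.v *)
Require Import Defs.
From HB Require Import structures.
From mathcomp Require Import all_boot all_order all_algebra.
From Stdlib Require Import Classical.

(* Call S "n-good" if the kernel of a right almost split map C_S -> k_S in add spread
   has spread-dimension at most n. Every representation is the kernel of a map between
   objects of add spread, and filtering the cokernel of the represented functors by
   simple functors shows that gldim_spread <= n as soon as all spreads are n-good.

   For a fixed poset all spreads are n-good for some n. Maps between spreads containing a
   point p that are nonzero at p form a partial order, so in any nonempty set Y of spreads
   there is X having a point p at which all maps from the other members of Y vanish. Such
   maps land in the proper up-set {x in X | ~ x <= p}, so coker(k_U -> k_X) involves,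
   besides X itself, only spreads outside Y; remove X from Y and repeat.

   For T x Q, cut T after the first and the last element of every slice of S and after
   their outer neighbours. This gives at most 1 + 4|Q| blocks, and the block map f has a
   right adjoint r (last element of a block). Pullback along f preserves add spread and
   spread-approximations because Hom(Z, f^*X) = Hom(r^*Z, X), and it turns the right
   almost split map of r^-1(S) into one of S. Hence goodness passes from
   [1 + 4|Q|] x Q to T x Q. *)

Set Implicit Arguments.
Unset Strict Implicit.
Unset Printing Implicit Defensive.

Import Order.TTheory GRing.Theory.

(** * Natural maps, liftings and kernels *)

Section Homomorphisms.
Local Open Scope ring_scope.

Lemma block_mul_row (K : fieldType) p q m1 m2 n1 n2 (U : 'M[K]_(p, q)) (A : 'M_(m1, n1))
    (D : 'M_(m2, n2)) (a : 'M_(p, m1 + m2)) (b : 'M_(q, n1 + n2)) :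
  U *m b = a *m block_mx A 0 0 D ->
  U *m lsubmx b = lsubmx a *m A /\ U *m rsubmx b = rsubmx a *m D.
Proof.
rewrite -{1}[b]hsubmxK -{1}[a]hsubmxK mul_row_block mul_mx_row.
by rewrite !mulmx0 addr0 add0r => /eq_row_mx.
Qed.

Lemma block_mul_col (K : fieldType) p q m1 m2 n1 n2 (U : 'M[K]_(p, q)) (A : 'M_(m1, n1))
    (D : 'M_(m2, n2)) (a : 'M_(m1 + m2, p)) (b : 'M_(n1 + n2, q)) :
  block_mx A 0 0 D *m b = a *m U ->
  A *m usubmx b = usubmx a *m U /\ D *m dsubmx b = dsubmx a *m U.
Proof.
rewrite -{1}[b]vsubmxK -{1}[a]vsubmxK mul_block_col [in X in _ = X]mul_col_mx.
by rewrite !mul0mx addr0 add0r => /eq_col_mx.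
Qed.

Variables (K : fieldType) (disp : Order.disp_t) (P : finPOrderType disp).
Implicit Types A B C D L M N Z : rep K P.

Definition idf M : homf M M := fun x => 1%:M.
Definition nullf M N : homf M N := fun x => 0.
Definition sumf M N (f g : homf M N) : homf M N := fun x => f x + g x.
Definition negf M N (f : homf M N) : homf M N := fun x => - f x.
Definition rowf Z M N (f : homf Z M) (g : homf Z N) : homf Z (dsum M N) :=
  fun x => row_mx (f x) (g x).
Definition colf M N Z (f : homf M Z) (g : homf N Z) : homf (dsum M N) Z :=
  fun x => col_mx (f x) (g x).

Lemma natural_id M : natural (idf M).
Proof. by move=> x y _; rewrite mulmx1 mul1mx. Qed.

Lemma natural_null M N : natural (nullf M N).
Proof. by move=> x y _; rewrite mulmx0 mul0mx. Qed.

Lemma natural_comp L M N (f : homf L M) (g : homf M N) :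
  natural f -> natural g -> natural (compf f g).
Proof. by move=> nf ng x y xy; rewrite /compf mulmxA nf // -mulmxA ng // mulmxA. Qed.

Lemma natural_add M N (f g : homf M N) : natural f -> natural g -> natural (sumf f g).
Proof. by move=> nf ng x y xy; rewrite /sumf mulmxDr mulmxDl nf // ng. Qed.

Lemma natural_opp M N (f : homf M N) : natural f -> natural (negf f).
Proof. by move=> nf x y xy; rewrite /negf mulmxN mulNmx nf. Qed.

Lemma natural_row Z M N (f : homf Z M) (g : homf Z N) :
  natural f -> natural g -> natural (rowf f g).
Proof.
move=> nf ng x y xy; rewrite /rowf /= mul_mx_row mul_row_block.
by rewrite !mulmx0 addr0 add0r nf // ng.
Qed.

Lemma natural_col M N Z (f : homf M Z) (g : homf N Z) :
  natural f -> natural g -> natural (colf f g).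
Proof.
move=> nf ng x y xy; rewrite /colf /= [RHS]mul_col_mx mul_block_col.
by rewrite !mul0mx addr0 add0r nf // ng.
Qed.

Lemma natural_restrict_row Z M N (f : homf Z (dsum M N)) : natural f ->
  natural (fun x => lsubmx (f x) : 'M_(rdim Z x, rdim M x)) /\
  natural (fun x => rsubmx (f x) : 'M_(rdim Z x, rdim N x)).
Proof.
move=> nf.
have e x y : (x <= y)%O -> _ /\ _ := fun xy => block_mul_row (nf x y xy).
by split=> x y /e[].
Qed.

Lemma natural_restrict_col Z M N (f : homf (dsum M N) Z) : natural f ->
  natural (fun x => usubmx (f x) : 'M_(rdim M x, rdim Z x)) /\
  natural (fun x => dsubmx (f x) : 'M_(rdim N x, rdim Z x)).
Proof.
move=> nf.
have e x y : (x <= y)%O -> _ /\ _ := fun xy => block_mul_col (nf x y xy).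
by split=> x y /e[].
Qed.

Lemma dsum_is_rep M N : is_rep M -> is_rep N -> is_rep (dsum M N).
Proof.
move=> [M1 M2] [N1 N2]; split=> [x|x y z xy yz] /=.
  by rewrite M1 N1 -scalar_mx_block.
by rewrite mulmx_block !mulmx0 !mul0mx !addr0 !add0r -M2 // -N2.
Qed.

Lemma zero_rep_is_rep : is_rep (zero_rep K P).
Proof. by split=> [x|x y z xy yz]; apply/matrixP=> -[]. Qed.

(** That is, [c] lies in the image of Hom(Z, g). Approximations and the vanishing of classes in
    coker Hom(-, g) are both phrased through it. *)
Definition lifts B C Z (g : homf B C) (c : homf Z C) : Prop :=
  exists h : homf Z B, natural h /\ forall x, h x *m g x = c x.

Lemma lifts_ext B C Z (g : homf B C) (c c' : homf Z C) :
  (forall x, c x = c' x) -> lifts g c -> lifts g c'.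
Proof. by move=> e [h [nh hg]]; exists h; split=> // x; rewrite hg. Qed.

Lemma lifts_null B C Z (g : homf B C) : lifts g (nullf Z C).
Proof. by exists (nullf Z B); split=> [|x]; [exact: natural_null|rewrite mul0mx]. Qed.

Lemma lifts_comp B C Y Z (g : homf B C) (u : homf Y Z) (c : homf Z C) :
  natural u -> lifts g c -> lifts g (compf u c).
Proof.
move=> nu [h [nh hg]]; exists (compf u h); split; first exact: natural_comp.
by move=> x; rewrite /compf -mulmxA hg.
Qed.

Lemma lifts_add B C Z (g : homf B C) (c d : homf Z C) :
  lifts g c -> lifts g d -> lifts g (sumf c d).
Proof.
move=> [h [nh hg]] [k [nk kg]]; exists (sumf h k); split; first exact: natural_add.
by move=> x; rewrite /sumf mulmxDl hg kg.
Qed.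

Lemma natural_scale M N (a : K) (f : homf M N) :
  natural f -> natural (fun x => a *: f x : 'M_(rdim M x, rdim N x)).
Proof. by move=> nf x y xy; rewrite -scalemxAr -scalemxAl nf. Qed.

Lemma lifts_scale B C Z (g : homf B C) (a : K) (c : homf Z C) :
  lifts g c -> lifts g (fun x => a *: c x : 'M_(rdim Z x, rdim C x)).
Proof.
move=> [h [nh hg]]; exists (fun x => a *: h x); split; first exact: natural_scale.
by move=> x; rewrite -scalemxAl hg.
Qed.

Lemma lifts_inl B S C Z (g : homf B C) (s : homf S C) (c : homf Z C) :
  lifts g c -> lifts (colf g s) c.
Proof.
move=> [h [nh hg]]; exists (rowf h (nullf Z S)); split.
  exact/natural_row/natural_null.
by move=> x; rewrite /rowf /colf mul_row_col hg mul0mx addr0.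
Qed.

Lemma lifts_inr B S C Z (g : homf B C) (s : homf S C) (c : homf Z C) :
  lifts s c -> lifts (colf g s) c.
Proof.
move=> [h [nh hg]]; exists (rowf (nullf Z B) h); split.
  by apply: natural_row => //; apply: natural_null.
by move=> x; rewrite /rowf /colf mul_row_col hg mul0mx add0r.
Qed.

Lemma lifts_dsum B C M N (g : homf B C) (h : homf (dsum M N) C) :
  lifts g (fun x => usubmx (h x) : 'M_(rdim M x, rdim C x)) ->
  lifts g (fun x => dsubmx (h x) : 'M_(rdim N x, rdim C x)) -> lifts g h.
Proof.
move=> [u [nu ug]] [d [nd dg]]; exists (colf u d); split; first exact: natural_col.
by move=> x; rewrite /colf mul_col_mx ug dg vsubmxK.
Qed.

(** Matrices act on row vectors from the right, so [row_free] is injectivity. The kernel is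
    characterised rather than constructed, which lets pullbacks and spliced sequences supply kernels
    of their own. *)
Definition is_ker M B C (i : homf M B) (g : homf B C) : Prop :=
  forall x, [/\ row_free (i x), i x *m g x = 0 & (kermx (g x) <= i x)%MS].

(** A pseudo-inverse of [i] gives the factorisation pointwise; naturality then follows by cancelling
    the injective [i y]. *)
Lemma ker_lift M B C Z (i : homf M B) (g : homf B C) (c : homf Z B) :
  natural i -> is_ker i g -> natural c -> (forall x, c x *m g x = 0) -> lifts i c.
Proof.
move=> ni ki nc cg; pose h x := c x *m pinvmx (i x).
have hi x : h x *m i x = c x.
  have [_ _ ke] := ki x; rewrite /h mulmxKpV //.
  by apply: submx_trans ke; apply/sub_kermxP.
exists h; split=> // x y xy; have [fr _ _] := ki y.
apply: (row_free_inj fr); rewrite -[LHS]mulmxA hi nc // -[RHS]mulmxA ni //.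
by rewrite mulmxA hi.
Qed.

(** Coordinates are taken in the basis [row_base] of each kernel; [pinvmx] reads off the coordinates
    of the image at [y]. *)
Definition ker_rep B C (g : homf B C) : rep K P :=
  @Rep K P (fun x => \rank (kermx (g x)))
    (fun x y => row_base (kermx (g x)) *m rmap B x y *m pinvmx (row_base (kermx (g y)))).

Definition ker_inc B C (g : homf B C) : homf (ker_rep g) B :=
  fun x => row_base (kermx (g x)).

Lemma ker_inc_is_ker B C (g : homf B C) : is_ker (ker_inc g) g.
Proof.
move=> x; split; first exact: row_base_free.
  by apply/sub_kermxP; rewrite eq_row_base.
by rewrite eq_row_base.
Qed.

Lemma ker_inc_natural B C (g : homf B C) : natural g -> natural (ker_inc g).
Proof.
move=> ng x y xy; rewrite /= /ker_inc mulmxKpV //.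
rewrite eq_row_base; apply/sub_kermxP; rewrite -mulmxA ng // mulmxA.
have /sub_kermxP -> : (row_base (kermx (g x)) <= kermx (g x))%MS by rewrite eq_row_base.
by rewrite mul0mx.
Qed.

Lemma sub_is_rep M B C (i : homf M B) (g : homf B C) :
  natural i -> is_ker i g -> is_rep B -> is_rep M.
Proof.
move=> ni ki [B1 B2]; have fr x : row_free (i x) by case: (ki x).
split=> [x|x y z xy yz]; apply: (row_free_inj (fr _)).
  by rewrite ni // B1 mulmx1 mul1mx.
rewrite -[RHS]mulmxA !ni ?(le_trans xy) // (B2 x y z) // mulmxA.
by rewrite -ni // -mulmxA -ni // mulmxA.
Qed.

End Homomorphisms.

(** * Indicator representations and add spread *)

Section Indicators.
Local Open Scope ring_scope.
Variables (K : fieldType) (disp : Order.disp_t) (P : finPOrderType disp).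
Implicit Types A B C D L M N Z W : rep K P.
Implicit Types p q : pred P.

(** Meant for sides of length 0 or 1: it returns the only entry, or 0 if there is none, and is
    multiplicative there. Maps between indicator representations thus become scalars, without casts
    between dimensions. *)
Definition mxs m n (A : 'M[K]_(m, n)) : K := \sum_i \sum_j A i j.

Lemma mxsK (b c : bool) (A : 'M[K]_(b, c)) : A = const_mx (mxs A).
Proof.
apply/matrixP=> i j; rewrite mxE /mxs; case: b i A => [|[]//] i A.
case: c j A => [|[]//] j A; rewrite big_ord1 big_ord1.
by rewrite (ord1 i) (ord1 j).
Qed.

Lemma mxs_const (b c : bool) (a : K) :
  mxs (const_mx a : 'M_(b, c)) = if b && c then a else 0.
Proof.
case: b; case: c; rewrite /mxs /= ?big_ord1 ?big_ord0 ?mxE //.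
Qed.

Lemma mxs_mul (a b c : bool) (A : 'M[K]_(a, b)) (B : 'M[K]_(b, c)) :
  mxs (A *m B) = mxs A * mxs B.
Proof.
case: a A => A; last by rewrite /mxs !big_ord0 mul0r.
case: b A B => A B; last first.
  rewrite (thinmx0 A) mul0mx /mxs [X in _ = _ * X]big_ord0 mulr0.
  by rewrite big1 // => i _; rewrite big1 // => j _; rewrite mxE.
case: c B => B; last first.
  by rewrite /mxs !big_ord1 !big_ord0 mulr0.
by rewrite /mxs !big_ord1 mxE big_ord1.
Qed.

Lemma mxsD m n (A B : 'M[K]_(m, n)) : mxs (A + B) = mxs A + mxs B.
Proof.
rewrite /mxs -big_split; apply: eq_bigr => i _ /=; rewrite -big_split.
by apply: eq_bigr => j _; rewrite mxE.
Qed.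

Lemma mxsZ m n a (A : 'M[K]_(m, n)) : mxs (a *: A) = a * mxs A.
Proof.
rewrite /mxs mulr_sumr; apply: eq_bigr => i _; rewrite mulr_sumr.
by apply: eq_bigr => j _; rewrite mxE.
Qed.

Lemma mxs_eq0 (b c : bool) (A : 'M[K]_(b, c)) : (mxs A == 0) = (A == 0).
Proof.
apply/eqP/eqP=> [e|->]; last by rewrite /mxs big1 // => i _; rewrite big1 // => j _; rewrite mxE.
by rewrite (mxsK A) e; apply/matrixP=> i j; rewrite !mxE.
Qed.

Lemma mxs_neq0 (b c : bool) (A : 'M[K]_(b, c)) : mxs A != 0 -> b /\ c.
Proof. by rewrite (mxsK A) mxs_const; case: b A; case: c => // A; rewrite eqxx. Qed.

Definition ev M N (f : homf M N) x : K := mxs (f x).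

Definition ind p : rep K P :=
  @Rep K P (fun x => nat_of_bool (p x)) (fun x y => const_mx 1).

Definition indf p q (a : P -> K) : homf (ind p) (ind q) := fun x => const_mx (a x).

Definition convexp p := forall s x s', p s -> p s' -> (s <= x)%O -> (x <= s')%O -> p x.

Lemma ind_is_rep p : convexp p -> is_rep (ind p).
Proof.
move=> cp; split=> [x|x y z xy yz] /=.
  by rewrite (mxsK 1%:M) /mxs; case: (p x); rewrite ?big_ord0 ?big_ord1 ?mxE //; apply/matrixP=> -[].
rewrite [RHS](@mxsK (p x) (p z)) (@mxs_mul (p x) (p y) (p z)) !mxs_const.
have := cp x y z; case: (p x) => //=; last by move=> _; apply/matrixP=> -[].
case: (p z) => /=; last by move=> _; apply/matrixP=> i [].
by move/(_ isT isT xy yz) => ->; rewrite mulr1.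
Qed.

(** This is the naturality square from [x] to [y]. If [p y] or [q x] fails, the value there is 0 and
    the square forces the other one to vanish too. *)
Lemma ev_natural p q (f : homf (ind p) (ind q)) x y :
  natural f -> (x <= y)%O -> p x -> q y -> ev f x = ev f y.
Proof.
move=> nf xy px qy; have := congr1 (@mxs _ _) (nf x y xy).
rewrite /= (@mxs_mul (p x) (p y) (q y)) (@mxs_mul (p x) (q x) (q y)) !mxs_const.
rewrite -/(ev f x) -/(ev f y) px qy /= andbT => e.
have -> : ev f y = (if p y then 1 else 0) * ev f y.
  case: ifP => [_|py]; first by rewrite mul1r.
  by rewrite mul0r; apply/eqP/negPn/negP=> /mxs_neq0; rewrite py => -[].
rewrite e; case: ifP => [_|qx]; first by rewrite mulr1.
by rewrite mulr0; apply/eqP/negPn/negP=> /mxs_neq0; rewrite qx => -[].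
Qed.

Lemma indf_natural p q (a : P -> K) :
  (forall x y, (x <= y)%O -> p x -> q y ->
     (if p y then a y else 0) = (if q x then a x else 0)) -> natural (indf p q a).
Proof.
move=> H x y xy; rewrite /indf /=.
rewrite [LHS](@mxsK (p x) (q y)) [RHS](@mxsK (p x) (q y)).
rewrite (@mxs_mul (p x) (p y) (q y)) (@mxs_mul (p x) (q x) (q y)) !mxs_const.
have := H x y xy; case: (p x) => //=; last by rewrite !mul0r.
case: (q y) => /=; last by rewrite !andbF !mulr0.
by rewrite !andbT => /(_ isT isT); case: (p y); case: (q x) => e; rewrite ?(mulr1, mul1r, mulr0, mul0r); congr const_mx.
Qed.

Lemma ev_comp p q r (f : homf (ind p) (ind q)) (g : homf (ind q) (ind r)) x :
  ev (compf f g) x = ev f x * ev g x.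
Proof. exact: (@mxs_mul (p x) (q x) (r x)). Qed.

Lemma ev_indf p q a x : ev (indf p q a) x = if p x && q x then a x else 0.
Proof. exact: mxs_const. Qed.

Lemma ev_neq0 p q (f : homf (ind p) (ind q)) x : ev f x != 0 -> p x /\ q x.
Proof. exact: mxs_neq0. Qed.

Lemma ev_eq0 p q (f : homf (ind p) (ind q)) x : (ev f x == 0) = (f x == 0).
Proof. exact: mxs_eq0. Qed.

Lemma ev_inj p q (f g : homf (ind p) (ind q)) x : ev f x = ev g x -> f x = g x.
Proof. by rewrite /ev => e; rewrite [LHS](@mxsK (p x) (q x)) e -(@mxsK (p x) (q x)). Qed.

Lemma ev_idf p x : p x -> ev (idf (ind p)) x = 1.
Proof.
move=> px; rewrite /ev (_ : idf (ind p) x = const_mx 1) ?(@mxs_const (p x) (p x)) ?px //.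
apply/matrixP; rewrite /idf /= px => i j; rewrite !mxE (ord1 i) (ord1 j) eqxx //.
Qed.

Lemma ind_iso p q : p =1 q ->
  natural (indf p q (fun _ => 1)) /\
  forall x, indf p q (fun _ => 1) x *m indf q p (fun _ => 1) x = 1%:M.
Proof.
move=> e; split; first by apply: indf_natural => x y _; rewrite !e => -> ->.
move=> x; apply: (@ev_inj p p (compf _ _) (idf _) x).
rewrite ev_comp !ev_indf e andbb; case: ifP => [qx|nqx].
  by rewrite mulr1 ev_idf // e.
by rewrite mulr0; apply/esym/eqP/negPn/negP=> /ev_neq0[]; rewrite e nqx.
Qed.

(** [Z] is a direct summand of [W]. *)
Definition retract Z W := exists (s : homf Z W) (r : homf W Z),
  natural s /\ natural r /\ (forall x, s x *m r x = 1%:M).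

Lemma retract_refl Z : retract Z Z.
Proof.
by exists (idf Z), (idf Z); split; [|split]; try exact: natural_id; move=> x; rewrite mulmx1.
Qed.

Lemma retract_trans Z W V : retract Z W -> retract W V -> retract Z V.
Proof.
move=> [s [r [ns [nr sr]]]] [s' [r' [ns' [nr' sr']]]].
exists (compf s s'), (compf r' r); split; [|split]; try exact: natural_comp.
by move=> x; rewrite /compf mulmxA -(mulmxA (s x)) sr' mulmx1.
Qed.

Lemma retract_ind p q : p =1 q -> retract (ind p) (ind q).
Proof.
move=> e; have [ns sr] := ind_iso e; have [nr _] := ind_iso (fsym e).
by exists (indf p q (fun _ => 1)), (indf q p (fun _ => 1)).
Qed.

Lemma retract_dsum Z W Z' W' : retract Z W -> retract Z' W' ->
  retract (dsum Z Z') (dsum W W').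
Proof.
move=> [s [r [ns [nr sr]]]] [s' [r' [ns' [nr' sr']]]].
exists (colf (rowf s (nullf Z W')) (rowf (nullf Z' W) s')).
exists (colf (rowf r (nullf W Z')) (rowf (nullf W' Z) r')).
have nn A B : natural (nullf A B) by apply: natural_null.
split; [|split]; try by apply: natural_col; apply: natural_row.
move=> x; rewrite /colf /rowf /nullf.
rewrite [LHS](mulmx_block (s x) 0 0 (s' x) (r x) 0 0 (r' x)).
by rewrite !mulmx0 !mul0mx !addr0 !add0r sr sr' -scalar_mx_block.
Qed.

Lemma retract_dsumA A B C : retract (dsum (dsum A B) C) (dsum A (dsum B C)).
Proof.
have nn A' B' : natural (nullf A' B') by apply: natural_null.
exists (colf (colf (rowf (idf A) (nullf _ _)) (rowf (nullf _ _) (rowf (idf B) (nullf _ _))))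
         (rowf (nullf _ _) (rowf (nullf _ _) (idf C)))).
exists (colf (rowf (rowf (idf A) (nullf _ _)) (nullf _ _))
         (colf (rowf (rowf (nullf _ _) (idf B)) (nullf _ _)) (rowf (nullf _ _) (idf C)))).
split; [|split]; try by do !(first [apply: natural_col|apply: natural_row]);
  try exact: natural_id.
move=> x; rewrite /colf /rowf /nullf /idf /=.
rewrite !mul_col_mx !mul_row_col !mul_mx_row !mul1mx !mul0mx !addr0 ?add0r.
rewrite !row_mx0 !addr0 !add0r.
have -> : col_mx (row_mx (row_mx 1%:M 0) 0) (row_mx (row_mx 0 1%:M) 0) =
    row_mx 1%:M 0 :> 'M[K]_(_, rdim A x + rdim B x + rdim C x).
  by rewrite -[LHS]/(block_mx _ _ _ _) block_mxEh -[col_mx _ _]/(block_mx _ _ _ _) -scalar_mx_block col_mx0.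
by rewrite -[LHS]/(block_mx _ _ _ _) -scalar_mx_block.
Qed.

Lemma retract_zero_dsum A : retract (dsum (zero_rep K P) A) A.
Proof.
have nn A' B' : natural (nullf A' B') by apply: natural_null.
exists (colf (nullf _ _) (idf A)), (rowf (nullf _ _) (idf A)).
split; [|split]; try by [apply: natural_col|apply: natural_row]; try exact: natural_id.
all: try by (apply: natural_col || apply: natural_row) => //; exact: natural_id.
move=> x; rewrite /colf /rowf /nullf /idf /= mul_col_row !mulmx1 mul0mx.
by rewrite [RHS](scalar_mx_block 0 (rdim A x)) mulmx0; congr block_mx; apply/matrixP=> -[].
Qed.

Definition spreads (Ss : seq {set P}) := bigdsum [seq spread_rep K S0 | S0 <- Ss].

Lemma retract_cat Ss Ss' : retract (dsum (spreads Ss) (spreads Ss')) (spreads (Ss ++ Ss')).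
Proof.
elim: Ss => [|S Ss IH] /=; first exact: retract_zero_dsum.
apply: retract_trans (retract_dsumA _ _ _) _.
exact: retract_dsum (retract_refl _) IH.
Qed.

Lemma add_is_rep Z : in_add_spread Z -> is_rep Z. Proof. by case. Qed.

Lemma add_retract Z W : is_rep Z -> retract Z W -> in_add_spread W -> in_add_spread Z.
Proof.
move=> rZ rt [_ [Ss [sp rt']]]; split=> //; exists Ss; split=> //.
exact: retract_trans rt rt'.
Qed.

Lemma add_dsum Z W : in_add_spread Z -> in_add_spread W -> in_add_spread (dsum Z W).
Proof.
move=> [rZ [Ss [sp rt]]] [rW [Ss' [sp' rt']]].
split; first exact: dsum_is_rep.
exists (Ss ++ Ss'); split; first by move=> S; rewrite mem_cat => /orP[/sp|/sp'].
exact: retract_trans (retract_dsum rt rt') (retract_cat _ _).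
Qed.

Lemma add_zero : in_add_spread (zero_rep K P).
Proof.
split; first exact: zero_rep_is_rep.
by exists [::]; split=> //; apply: retract_refl.
Qed.

Lemma spread_is_rep (S : {set P}) : convex S -> is_rep (spread_rep K S).
Proof.
move=> cS; apply: (@ind_is_rep (fun x => x \in S)) => s x s'; exact: cS.
Qed.

Lemma add_spread (S : {set P}) : is_spread S -> in_add_spread (spread_rep K S).
Proof.
move=> sS; split; first by apply: spread_is_rep; case: sS => _ [].
exists [:: S]; split; first by move=> S0; rewrite inE => /eqP->.
exists (rowf (idf _) (nullf _ _)), (colf (idf _) (nullf _ _)).
split; [|split].
- by apply: natural_row; [apply: natural_id|apply: natural_null].
- by apply: natural_col; [apply: natural_id|apply: natural_null].
by move=> x; rewrite /rowf /colf mul_row_col mulmx1 mulmx0 addr0.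
Qed.

Lemma add_spreads (Ss : seq {set P}) : (forall S, S \in Ss -> is_spread S) -> in_add_spread (spreads Ss).
Proof.
elim: Ss => [|S Ss IH] H; first exact: add_zero.
apply: add_dsum; first by apply: add_spread; apply: H; rewrite mem_head.
by apply: IH => S' S'in; apply: H; rewrite inE S'in orbT.
Qed.

End Indicators.

(** * Connected components and maps between spreads *)

Section Spreads.
Local Open Scope ring_scope.
Variables (K : fieldType) (disp : Order.disp_t) (P : finPOrderType disp).
Implicit Types A B C D L M N Z W : rep K P.
Implicit Types p q : pred P.
Implicit Types S U V : {set P}.
Local Notation spr S := (spread_rep K S).

Definition component U x : {set P} := [set y | connect (spread_rel U) x y].

Lemma spread_rel_sym U : connect_sym (spread_rel U).
Proof.
by apply: sym_connect_sym => x y; rewrite /spread_rel orbC andbCA.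
Qed.

Lemma spread_rel_closed U : closed (spread_rel U) U.
Proof. by move=> x y /and3P[-> ->]. Qed.

Lemma component_sub U x y : x \in U -> y \in component U x -> y \in U.
Proof. by rewrite inE => xU /(closed_connect (@spread_rel_closed U)) <-. Qed.

Lemma component_step U x y z : x \in U -> y \in component U x -> z \in U ->
  (y <= z)%O || (z <= y)%O -> z \in component U x.
Proof.
move=> xU yC zU yz; move: (yC); rewrite !inE => xy; apply: connect_trans xy _.
by apply: connect1; rewrite /spread_rel zU yz (component_sub xU yC).
Qed.

Lemma component_connected U x : x \in U -> connected_set (component U x).
Proof.
move=> xU; set V := component U x.
have xV : x \in V by rewrite inE.
have key y : y \in V -> connect (spread_rel V) x y.
  rewrite {1}inE => xy.
  have cl : closed (spread_rel U) [pred z | connect (spread_rel V) x z].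
    apply: intro_closed; first exact: spread_rel_sym.
    move=> a b /and3P[aU bU ab]; rewrite !inE => xa.
    have aV : a \in V by rewrite -(closed_connect (@spread_rel_closed V) xa).
    apply: connect_trans xa _; apply: connect1.
    by rewrite /spread_rel aV ab (component_step xU aV bU ab).
  by have := closed_connect cl xy; rewrite !inE connect0 => <-.
move=> y z /key xy /key xz; apply: connect_trans xz.
by rewrite spread_rel_sym.
Qed.

Lemma component_convex U x : x \in U -> convex U -> convex (component U x).
Proof.
move=> xU cU s p s' sV s'V sp ps'.
have pU : p \in U by apply: (cU s p s') => //; apply: component_sub xU _.
by apply: component_step xU sV pU _; rewrite sp.
Qed.

(** No element of a component [V] is comparable to an element of [U :\: V], so the representation of
    [U] splits as the sum of those of [V] and of the rest; induct on the size of [U]. *)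
Lemma add_set U : convex U -> in_add_spread (spr U).
Proof.
have [n] := ubnP #|U|; elim: n U => // n IH U Un cU.
have [->|[x xU]] := set_0Vmem U.
  apply: add_retract (add_zero K P).
    by apply: spread_is_rep => s p s'; rewrite inE.
  exists (nullf _ _), (nullf _ _); split; [|split]; try exact: natural_null.
  by move=> x; rewrite mul0mx; apply/matrixP=> -[k kx]; exfalso; move: kx; rewrite /= inE.
set V := component U x; set W := U :\: V.
have xV : x \in V by rewrite inE.
have VU y : y \in V -> y \in U by apply: component_sub.
have spV : is_spread V.
  split; first by apply/set0Pn; exists x.
  by split; [apply: component_convex|apply: component_connected].
have cW : convex W.
  move=> s p s'; rewrite !in_setD => /andP[sV sU] /andP[s'V s'U] sp ps'.
  have pU : p \in U by apply: (cU s p s').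
  rewrite pU andbT; apply: contra sV => pV.
  by apply: component_step pV sU _; rewrite ?sp ?orbT.
have W_lt : (#|W| < n)%N.
  rewrite ltnS in Un; apply: leq_trans Un; apply: proper_card.
  rewrite properE subsetDl /=; apply/subsetPn; exists x => //.
  by rewrite in_setD xV.
have rU := @spread_is_rep K _ P U cU.
apply: add_retract rU _ (add_dsum (add_spread K spV) (IH W W_lt cW)).
have step a b : (a <= b)%O || (b <= a)%O -> a \in U -> b \in U -> (a \in V) = (b \in V).
  move=> ab aU bU; apply/idP/idP => h; first exact: component_step ab.
  by apply: (component_step xU h aU); rewrite orbC.
pose mU y := y \in U; pose mV y := y \in V; pose mW y := y \in W.
exists (rowf (indf mU mV (fun _ => 1)) (indf mU mW (fun _ => 1))).
exists (colf (indf mV mU (fun _ => 1)) (indf mW mU (fun _ => 1))).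
split; [|split].
- apply: natural_row; apply: indf_natural => a b ab; rewrite /mU /mV /mW => aU.
    by move=> bV; rewrite (VU _ bV) (step a b) ?ab ?(VU _ bV) // bV.
  rewrite !in_setD => /andP[bV bU]; rewrite aU bU (step a b) ?ab //.
  by rewrite (negbTE bV).
- apply: natural_col; apply: indf_natural => a b ab; rewrite /mU /mV /mW.
    by move=> aV bU; rewrite (VU _ aV) -(step a b) ?ab ?(VU _ aV) // aV.
  rewrite !in_setD => /andP[aV aU] bU; rewrite aU bU -(step a b) ?ab //.
  by rewrite (negbTE aV).
move=> y; rewrite /rowf /colf mul_row_col.
rewrite [LHS](@mxsK _ (mU y) (mU y)) [RHS](@mxsK _ (mU y) (mU y)).
congr const_mx.
rewrite mxsD -[X in X + _]/(ev (compf (indf mU mV (fun=> 1)) (indf mV mU (fun=> 1))) y).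
rewrite -[X in _ + X]/(ev (compf (indf mU mW (fun=> 1)) (indf mW mU (fun=> 1))) y).
rewrite -[RHS]/(ev (idf (ind K mU)) y) !ev_comp !ev_indf /mU /mV /mW in_setD.
have [yV|nyV] := boolP (y \in V).
  by rewrite (VU _ yV) /= mulr1 mul0r addr0 ev_idf // /mU (VU _ yV).
have [yU|nyU] := boolP (y \in U); first by rewrite /= mul0r add0r mulr1 ev_idf.
by rewrite /= !mul0r addr0; apply/esym/eqP/negPn/negP => /ev_neq0[]; rewrite /mU (negbTE nyU).
Qed.

Lemma add_ind p : convexp p -> in_add_spread (ind K p).
Proof.
move=> cp; apply: add_retract (ind_is_rep K cp) _ (@add_set [set x | p x] _).
  by apply: (@retract_ind _ _ _ p (fun x => x \in [set x | p x])) => x; rewrite inE.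
by move=> s x s'; rewrite !inE; apply: cp.
Qed.

(** [Z] is a summand of a sum of spreads, so a lift can be assembled from lifts on the individual
    spreads. *)
Lemma add_lifts B C Z (g : homf B C) (h : homf Z C) : in_add_spread Z -> natural h ->
  (forall V (u : homf (spr V) Z), is_spread V -> natural u -> lifts g (compf u h)) ->
  lifts g h.
Proof.
move=> [_ [Ss [sp [s [r [ns [nr sr]]]]]]] nh H.
have : lifts g (compf r h).
  have nrh : natural (compf r h) by apply: natural_comp.
  have {}H V (u : homf (spr V) (spreads K Ss)) : is_spread V -> natural u ->
      lifts g (compf u (compf r h)).
    move=> sV nu; apply: lifts_ext (H V (compf u r) sV _); last exact: natural_comp.
    by move=> x; rewrite /compf mulmxA.
  move: (compf r h) nrh H => k nk H {s r ns nr sr nh h}.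
  elim: Ss sp k nk H => [|S Ss IH] sp k nk H.
    by exists (nullf _ _); split; [apply: natural_null|move=> x; apply/matrixP=> -[]].
  have [nu nd] := natural_restrict_col nk.
  have nn A' B' : natural (@nullf K _ P A' B') by apply: natural_null.
  apply: lifts_dsum.
    apply: lifts_ext (H S (rowf (idf _) (nullf _ _)) _ _).
    - by move=> x; rewrite /compf /rowf -[k x]vsubmxK mul_row_col mul1mx mul0mx addr0 vsubmxK.
    - by apply: sp; rewrite mem_head.
    - by apply: natural_row => //; apply: natural_id.
  apply: IH => //; first by move=> S' S'in; apply: sp; rewrite inE S'in orbT.
  move=> V u sV nu'; apply: lifts_ext (H V (rowf (nullf _ _) u) sV _); last exact: natural_row.
  by move=> x; rewrite /compf /rowf -[k x]vsubmxK mul_row_col mul0mx add0r vsubmxK.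
move/(lifts_comp ns); apply: lifts_ext => x.
by rewrite /compf mulmxA sr mul1mx.
Qed.

Lemma spreads_null Ss Z N (u : homf Z (spreads K Ss)) (w : homf (spreads K Ss) N) :
  natural u -> natural w ->
  (forall S (a : homf Z (spr S)) (b : homf (spr S) N), S \in Ss -> natural a -> natural b ->
     forall x, a x *m b x = 0) ->
  forall x, u x *m w x = 0.
Proof.
elim: Ss u w => [|S Ss IH] u w nu nw H x.
  by rewrite (_ : w x = 0) ?mulmx0 //; apply/matrixP=> -[].
have [nu1 nu2] := natural_restrict_row nu; have [nw1 nw2] := natural_restrict_col nw.
rewrite -[u x]hsubmxK -[w x]vsubmxK mul_row_col.
rewrite (H S _ _ (mem_head _ _) nu1 nw1) add0r; apply: (IH _ _ nu2 nw2) => S' a b S'in.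
by apply: (H S' a b); rewrite inE S'in orbT.
Qed.

Lemma ev_connected S q (f : homf (spr S) (ind K q)) : connected_set S -> natural f ->
  (forall x, x \in S -> q x) -> forall x y, x \in S -> y \in S -> ev f x = ev f y.
Proof.
move=> cS nf Sq x y xS yS.
have cl : closed (spread_rel S) [pred z | ev f z == ev f x].
  apply: intro_closed; first exact: spread_rel_sym.
  move=> a b /and3P[aS bS /orP[ab|ba]]; rewrite !inE => /eqP <-.
    by rewrite (@ev_natural _ _ _ (fun x => x \in S) q f a b) // Sq.
  by rewrite (@ev_natural _ _ _ (fun x => x \in S) q f b a) // Sq.
by have := closed_connect cl (cS x y xS yS); rewrite !inE eqxx => /esym/eqP.
Qed.

(** The endomorphism of [spr S] through [spr V] is nonzero at [x], hence on all of the connected set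
    [S], so [S] lies in [V]; the other inclusion is symmetric. *)
Lemma spread_antisym S V (u : homf (spr V) (spr S)) (w : homf (spr S) (spr V)) x :
  connected_set S -> connected_set V -> natural u -> natural w ->
  ev u x != 0 -> ev w x != 0 -> V = S.
Proof.
pose mS y := y \in S; pose mV y := y \in V.
move=> cS cV nu nw u0 w0.
have [xV xS] := @ev_neq0 _ _ _ mV mS u x u0.
have sub S' V' (u' : homf (spr V') (spr S')) (w' : homf (spr S') (spr V')) :
    connected_set S' -> natural u' -> natural w' -> x \in S' ->
    ev u' x != 0 -> ev w' x != 0 -> S' \subset V'.
  move=> cS' nu' nw' xS' u0' w0'; apply/subsetP=> y yS'.
  pose m1 y := y \in S'; pose m2 y := y \in V'.
  have e := @ev_connected S' m1 (compf w' u') cS' (natural_comp nw' nu') (fun _ => id) x y xS' yS'.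
  have : ev (compf w' u') y != 0.
    by rewrite -e (@ev_comp _ _ _ m1 m2 m1) mulf_neq0.
  rewrite (@ev_comp _ _ _ m1 m2 m1) mulf_eq0 negb_or => /andP[+ _].
  by move/(@ev_neq0 _ _ _ m1 m2 w') => [].
apply/eqP; rewrite eqEsubset; apply/andP; split.
  exact: (sub V S w u).
exact: (sub S V u w).
Qed.

(* Descent along a relation whose chains never repeat a label stops, since
   there are finitely many labels. *)
Lemma label_descent (I : finType) (A : Type) (lab : A -> I) (R : A -> A -> Prop) (a0 : A) :
  (forall a b c, R a b -> R b c -> R a c) -> (forall a b, R a b -> lab a <> lab b) ->
  exists a, (a = a0 \/ R a a0) /\ forall b, ~ R b a.
Proof.
move=> tr ir.
have H n (F : {set I}) a : (#|~: F| < n)%N -> (forall b, b = a \/ R b a -> lab b \notin F) ->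
    exists c, (c = a \/ R c a) /\ forall b, ~ R b c.
  elim: n F a => // n IH F a Fn aF.
  have [[b Rba]|no] := classic (exists b, R b a); last first.
    by exists a; split; [left|move=> b Rb; apply: no; exists b].
  have [||c [cb cm]] := IH (lab a |: F) b.
  - rewrite ltnS in Fn; apply: leq_trans Fn; apply: proper_card.
    rewrite properE setCS subsetU1 /=; apply/subsetPn; exists (lab a).
      by rewrite inE aF //; left.
    by rewrite !inE eqxx.
  - move=> c cb; have Rca : R c a by case: cb => [->//|/tr]; apply.
    rewrite !inE negb_or (aF c) ?andbT; last by right.
    by apply/eqP; apply: ir.
  by exists c; split=> //; right; case: cb => [->//|/tr]; apply.
have [||c [ca cm]] := H #|~: set0 : {set I}|.+1 set0 a0; rewrite ?ltnSn //.
  by move=> b _; rewrite inE.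
by exists c.
Qed.

End Spreads.

(** * Spread-dimension *)

Section Dimension.
Local Open Scope ring_scope.
Variables (K : fieldType) (disp : Order.disp_t) (P : finPOrderType disp).
Implicit Types A B C D L M N Z W : rep K P.
Implicit Types S U V : {set P}.
Local Notation spr S := (spread_rep K S).

Lemma is_kerI M B C (i : homf M B) (g : homf B C) :
  (forall x m (v : 'M_(m, rdim M x)), v *m i x = 0 -> v = 0) ->
  (forall x, i x *m g x = 0) ->
  (forall x m (v : 'M_(m, rdim B x)), v *m g x = 0 -> exists w, v = w *m i x) ->
  is_ker i g.
Proof.
move=> inj zer ex x; split=> //; last first.
  by have [|w ->] := ex x _ (kermx (g x)); rewrite ?mulmx_ker ?submxMl.
by rewrite -kermx_eq0; apply/eqP/inj/mulmx_ker.
Qed.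

Lemma ker_inj M B C (i : homf M B) (g : homf B C) x m (v w : 'M_(m, _)) :
  is_ker i g -> v *m i x = w *m i x -> v = w.
Proof. by move=> ki; apply: row_free_inj; case: (ki x). Qed.

Lemma ker_comp M B C (i : homf M B) (g : homf B C) x : is_ker i g -> i x *m g x = 0.
Proof. by move=> ki; case: (ki x). Qed.

Lemma ker_ex M B C (i : homf M B) (g : homf B C) x m (v : 'M_(m, _)) :
  is_ker i g -> v *m g x = 0 -> exists w, v = w *m i x.
Proof.
move=> ki vg; have [_ _ ke] := ki x.
have : (v <= i x)%MS by apply: submx_trans ke; apply/sub_kermxP.
by case/submxP => w ->; exists w.
Qed.

Definition approx C M (f : homf C M) : Prop :=
  forall Z (g : homf Z M), in_add_spread Z -> natural g -> lifts f g.

Lemma approx_spreads C M (f : homf C M) :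
  (forall V (u : homf (spr V) M), is_spread V -> natural u -> lifts f u) -> approx f.
Proof.
move=> H Z g aZ ng; apply: add_lifts => // V u sV nu.
by apply: H => //; apply: natural_comp.
Qed.

(** Spread-dimension at most [n], unfolded one kernel at a time so that induction on [n] applies;
    [dimle_resolution] and [spread_dim_dimle] compare it with resolutions. *)
Fixpoint dimle n M : Prop :=
  if n is n'.+1 then
    exists C (f : homf C M) L (k : homf L C),
      [/\ in_add_spread C, natural f & approx f] /\ [/\ natural k, is_ker k f & dimle n' L]
  else in_add_spread M.

Lemma dimleS n M : is_rep M -> dimle n M -> dimle n.+1 M.
Proof.
elim: n M => [|n IH] M rM.
  move=> aM; exists M, (idf M), (zero_rep K P), (nullf _ _).
  split; first split=> //; try exact: natural_id.
    by move=> Z g _ ng; exists g; split=> // x; rewrite mulmx1.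
  split; [exact: natural_null| |exact: add_zero].
  apply: is_kerI => x; first by move=> m v _; apply/matrixP=> i [].
    by rewrite mul0mx.
  by move=> m v; rewrite mulmx1 => ->; exists 0; rewrite mulmx0.
move=> [C [f [L [k [[aC nf af] [nk ik dL]]]]]]; exists C, f, L, k; split; split=> //.
by apply: IH => //; apply: sub_is_rep ik (add_is_rep aC).
Qed.

Lemma dimle_leq n m M : is_rep M -> (n <= m)%N -> dimle n M -> dimle m M.
Proof.
move=> rM; elim: m => [|m IH]; first by rewrite leqn0 => /eqP->.
by rewrite leq_eqVlt => /orP[/eqP->//|nm /(IH nm)]; apply: dimleS.
Qed.

(** A horseshoe lemma: the sequence stays exact under Hom(Z, -) for [Z] in add spread, so
    approximations of [A] and [C] combine to one of [B], whose kernel is again such an extension of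
    the two kernels. *)
Lemma dimle_ext n A B C (i : homf A B) (p : homf B C) :
  is_rep B -> natural i -> natural p -> is_ker i p -> approx p ->
  dimle n A -> dimle n C -> dimle n B.
Proof.
elim: n A B C i p => [|n IH] A B C i p rB ni np ki ap.
  (* The identity of [C] lifts through [p], so the sequence splits. *)
  move=> aA aC; have [s [ns sp]] := ap C (idf C) aC (@natural_id _ _ _ C).
  have [||a [na ai]] := @ker_lift _ _ _ _ _ _ _ i p (sumf (idf B) (negf (compf p s))) ni ki.
  - by apply: natural_add; [apply: natural_id|apply/natural_opp/natural_comp].
  - by move=> x; rewrite /sumf /negf /compf mulmxDl mulNmx -mulmxA sp mulmx1 mul1mx subrr.
  apply: add_retract rB _ (add_dsum aA aC).
  exists (rowf a p), (colf i s); split; [exact: natural_row|split; first exact: natural_col].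
  by move=> x; rewrite /rowf /colf mul_row_col ai /sumf /negf /compf subrK.
move=> [CA [fA [KA [kA [[aCA nfA afA] [nkA ikA dKA]]]]]].
move=> [CC [fC [KC [kC [[aCC nfC afC] [nkC ikC dKC]]]]]].
have [s [ns sp]] := ap _ fC aCC nfC.
pose f := colf (compf fA i) s.
have nf : natural f by apply: natural_col => //; apply: natural_comp.
have aD : in_add_spread (dsum CA CC) by apply: add_dsum.
have toA Z (z : homf Z B) : in_add_spread Z -> natural z -> (forall x, z x *m p x = 0) ->
    exists b : homf Z CA, natural b /\ forall x, b x *m (fA x *m i x) = z x.
  move=> aZ nz /(ker_lift ni ki nz)[a [na ai]].
  have [b [nb bf]] := afA Z a aZ na.
  by exists b; split=> // x; rewrite mulmxA bf ai.
exists (dsum CA CC), f, (ker_rep f), (ker_inc f).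
have nk := ker_inc_natural nf; have kk := ker_inc_is_ker f.
split; split=> //.
  move=> Z g aZ ng.
  have [h [nh hf]] := afC Z (compf g p) aZ (natural_comp ng np).
  have [|x|b [nb bf]] := toA Z (sumf g (negf (compf h s))) aZ.
  - by apply/natural_add/natural_opp/natural_comp.
  - by rewrite /sumf /negf /compf mulmxDl mulNmx -mulmxA sp hf subrr.
  exists (rowf b h); split; first exact: natural_row.
  by move=> x; rewrite /rowf /f /colf mul_row_col bf /sumf /negf /compf subrK.
have [nk1 nk2] := natural_restrict_row nk.
set k1 := fun x : P => _ in nk1; set k2 := fun x : P => _ in nk2.
have kE x : ker_inc f x = row_mx (k1 x) (k2 x) by rewrite hsubmxK.
have k12 x : k1 x *m (fA x *m i x) + k2 x *m s x = 0.
  by have := ker_comp x kk; rewrite kE /f /colf mul_row_col.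
have [||i' [ni' ik']] := @ker_lift _ _ _ _ _ _ _ _ f (rowf kA (nullf KA CC)) nk kk.
- by apply/natural_row/natural_null.
- by move=> x; rewrite /rowf /f /colf mul_row_col mul0mx addr0 mulmxA (ker_comp x ikA) mul0mx.
have [|p' [np' pk']] := @ker_lift _ _ _ _ _ _ _ _ fC k2 nkC ikC nk2.
- move=> x; have := congr1 (mulmx^~ (p x)) (k12 x).
  by rewrite /= mulmxDl mul0mx -!mulmxA sp (ker_comp x ki) !mulmx0 add0r.
have rK : is_rep (ker_rep f) by apply: sub_is_rep kk (add_is_rep aD).
have i'E x : i' x *m k1 x = kA x /\ i' x *m k2 x = 0.
  by have := ik' x; rewrite kE mul_mx_row => /eq_row_mx.
apply: (IH KA _ KC i' p') => //.
- apply: is_kerI => x.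
  + move=> m v v0; apply: (ker_inj (x := x) ikA).
    by rewrite -(i'E x).1 mulmxA v0 !mul0mx.
  + apply: (ker_inj (x := x) ikC); rewrite -mulmxA pk' mul0mx.
    exact: (i'E x).2.
  move=> m v vp; have vk2 : v *m k2 x = 0 by rewrite -pk' mulmxA vp mul0mx.
  have : v *m k1 x *m fA x = 0.
    apply: (ker_inj (x := x) ki); rewrite mul0mx -mulmxA -[LHS]mulmxA.
    by have := congr1 (mulmx v) (k12 x); rewrite mulmxDr [v *m (k2 x *m _)]mulmxA vk2 mul0mx addr0 mulmx0.
  case/(ker_ex ikA) => w wE; exists w; apply: (ker_inj (x := x) kk).
  by rewrite kE mul_mx_row vk2 wE -mulmxA -kE ik' /rowf mul_mx_row mulmx0.
move=> Z z aZ nz.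
have [|x|b [nb bf]] := toA Z (compf (compf z kC) s) aZ.
- by do 2!apply: natural_comp => //.
- by rewrite /compf -!mulmxA sp (ker_comp x ikC) mulmx0.
have [||c [nc ck]] := @ker_lift _ _ _ _ _ _ _ _ f (rowf (negf b) (compf z kC)) nk kk.
- by apply: natural_row; [apply: natural_opp|apply: natural_comp].
- by move=> x; rewrite /rowf /f /colf mul_row_col /negf mulNmx bf addNr.
exists c; split=> // x; apply: (ker_inj (x := x) ikC); rewrite -mulmxA pk'.
by have := ck x; rewrite kE mul_mx_row => /eq_row_mx[].
Qed.

(** In an approximation [f] of the sum, the component [f2] onto [C] splits, so its kernel [L'] is in
    add spread. Restricted to [L'], the other component approximates [A] and has the same kernel as
    [f]. *)
Lemma dimle_summand n A C : is_rep A -> in_add_spread C -> dimle n (dsum A C) -> dimle n A.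
Proof.
have nn A' B' : natural (@nullf K _ P A' B') by apply: natural_null.
have nI A' : natural (@idf K _ P A') by apply: natural_id.
move=> rA aC; case: n => [|n].
  apply: add_retract rA _; exists (rowf (idf _) (nullf _ _)), (colf (idf _) (nullf _ _)).
  split; [exact: natural_row|split; first exact: natural_col].
  by move=> x; rewrite /rowf /colf mul_row_col mulmx1 mulmx0 addr0.
move=> [D [f [L [k [[aD nf af] [nk ik dL]]]]]].
have [nf1 nf2] := natural_restrict_row nf.
set f1 := fun x : P => _ in nf1; set f2 := fun x : P => _ in nf2.
have fE x : f x = row_mx (f1 x) (f2 x) by rewrite hsubmxK.
have [s [ns sf]] := af C (rowf (nullf _ _) (idf C)) aC (natural_row (nn _ _) (nI _)).
have sf2 x : s x *m f2 x = 1%:M.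
  by have := sf x; rewrite fE mul_mx_row => /eq_row_mx[].
have nk' := ker_inc_natural nf2; have kk' := ker_inc_is_ker f2.
set L' := ker_rep f2 in nk' kk'; set k' := ker_inc f2 in nk' kk'.
have rL' : is_rep L' by apply: sub_is_rep kk' (add_is_rep aD).
have aL' : in_add_spread L'.
  apply: add_retract rL' _ aD.
  have [||t [nt tk]] := @ker_lift _ _ _ _ _ _ _ k' f2 (sumf (idf D) (negf (compf f2 s))) nk' kk'.
  - by apply: natural_add => //; apply/natural_opp/natural_comp.
  - by move=> x; rewrite /sumf /negf /compf mulmxDl mulNmx -mulmxA sf2 mulmx1 mul1mx subrr.
  exists k', t; split=> //; split=> // x; apply: (ker_inj (x := x) kk').
  rewrite -mulmxA tk /sumf /negf /compf mulmxDr mulmxN mulmxA (ker_comp x kk').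
  by rewrite mul0mx subr0 mulmx1 mul1mx.
have [|j [nj jk]] := ker_lift nk' kk' nk.
  by move=> x; have := ker_comp x ik; rewrite fE mul_mx_row -row_mx0 => /eq_row_mx[].
exists L', (compf k' f1), L, j; split; split=> //; first exact: natural_comp.
  move=> Z g aZ ng.
  have [h [nh hf]] := af Z (rowf g (nullf _ _)) aZ (natural_row ng (nn _ _)).
  have hfE x : h x *m f1 x = g x /\ h x *m f2 x = 0.
    by have := hf x; rewrite fE mul_mx_row => /eq_row_mx.
  have [|h' [nh' hk']] := ker_lift nk' kk' nh; first by move=> x; case: (hfE x).
  by exists h'; split=> // x; rewrite /compf mulmxA hk'; case: (hfE x).
apply: is_kerI => x.
- move=> m v v0; apply: (ker_inj (x := x) ik).
  by rewrite -jk mulmxA v0 !mul0mx.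
- rewrite /compf mulmxA jk; have := ker_comp x ik.
  by rewrite fE mul_mx_row -row_mx0 => /eq_row_mx[].
move=> m v vf; have : v *m k' x *m f x = 0.
  rewrite fE mul_mx_row -(mulmxA v (k' x) (f1 x)) -(mulmxA v (k' x) (f2 x)) (ker_comp x kk').
  by move: vf; rewrite /compf => ->; rewrite mulmx0 row_mx0.
case/(ker_ex ik) => w wE; exists w; apply: (ker_inj (x := x) kk').
by rewrite -mulmxA jk.
Qed.

End Dimension.

(** * Resolutions, and existence of approximations *)

Section Resolutions.
Local Open Scope ring_scope.
Variables (K : fieldType) (disp : Order.disp_t) (P : finPOrderType disp).
Implicit Types A B C D L M N Z W : rep K P.
Implicit Types S U V : {set P}.
Local Notation spr S := (spread_rep K S).

Lemma null_to_zero Z (f : homf Z (zero_rep K P)) x : f x = 0.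
Proof. by apply/matrixP=> i []. Qed.

Lemma dimle_resolution n M : dimle n M ->
  exists R : spread_resolution M, is_spread_resolution R /\ is_zero_rep (sr_C R n.+1).
Proof.
suff H : dimle n M -> exists R : spread_resolution M, is_spread_resolution R /\
    forall i, (n <= i)%N -> is_zero_rep (sr_C R i.+1).
  by move/H => [R [rR zR]]; exists R; split=> //; apply: zR.
elim: n M => [|n IH] M.
  move=> aM.
  exists (@SpreadRes K _ P M (fun i => if i is 0 then M else zero_rep K P) (idf M)
     (fun i => nullf _ _)); split; last by [].
  split; first by case=> [|i]; [|apply: add_zero].
  split; first exact: natural_id.
  split; first by move=> i; apply: natural_null.
  split; first by move=> x; rewrite /compf mul0mx.
  split; first by move=> i x; rewrite /compf mul0mx.
  split; first by move=> Z g _ ng; exists g; split=> // x; rewrite /compf mulmx1.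
  split.
    move=> Z g aZ ng g0; exists (nullf _ _); split; first exact: natural_null.
    by move=> x; have := g0 x; rewrite /compf mulmx1 mul0mx => ->.
  move=> i Z g aZ ng g0; exists (nullf _ _); split; first exact: natural_null.
  by move=> x; rewrite [RHS]null_to_zero; apply: null_to_zero.
move=> [C [f [L [k [[aC nf af] [nk ik dL]]]]]].
have [R [rR zR]] := IH L dL; case: rR => aR [neR [ndR [z0 [zS [s0 [s1 sS]]]]]].
exists (@SpreadRes K _ P M (fun i => if i is j.+1 then sr_C R j else C) f
  (fun i => match i with 0 => compf (sr_e R) k | j.+1 => sr_d R j end)).
split; last by case=> // i; apply: zR.
split; first by case.
split; first by [].
split; first by case=> //=; apply: natural_comp.
split; first by move=> x /=; rewrite /compf -mulmxA (ker_comp x ik) mulmx0.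
split.
  case=> [|i] x /=; last exact: zS.
  by rewrite /compf mulmxA; have := z0 x; rewrite /compf => ->; rewrite mul0mx.
split; first by move=> Z g aZ ng; apply: af.
split.
  move=> Z g aZ ng /(ker_lift nk ik ng)[a [na ak]].
  have [h [nh ha]] := s0 Z a aZ na; exists h; split=> // x /=.
  by rewrite /compf mulmxA; have := ha x; rewrite /compf => ->.
case=> [|i] Z g aZ ng g0; last exact: (sS i).
apply: s1 => // x; apply: (ker_inj (x := x) ik); rewrite mul0mx.
by have := g0 x; rewrite /= /compf mulmxA.
Qed.

(** Its representation is the indecomposable projective at [x], which represents evaluation at
    [x]. *)
Definition upset (x : P) : {set P} := [set y | (x <= y)%O].

Lemma upset_spread x : is_spread (upset x).
Proof.
split; first by apply/set0Pn; exists x; rewrite inE.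
split; first by move=> s y s'; rewrite !inE => xs _ sy _; apply: le_trans sy.
have st y : y \in upset x -> connect (spread_rel (upset x)) x y.
  by rewrite inE => xy; apply: connect1; rewrite /spread_rel !inE lexx xy.
by move=> y z /st xy /st; apply: connect_trans; rewrite spread_rel_sym.
Qed.

Lemma yoneda M x (v : 'rV_(rdim M x)) : is_rep M ->
  exists u : homf (spr (upset x)) M, [/\ natural u,
    exists e : 'rV_(rdim (spr (upset x)) x), e *m u x = v &
    forall N (f : homf M N), natural f -> v *m f x = 0 -> forall y, u y *m f y = 0].
Proof.
move=> [M1 M2].
exists (fun y => (const_mx 1 : 'M_(rdim (spr (upset x)) y, 1)) *m (v *m rmap M x y)).
split.
- move=> a b ab /=.
  have [xa|nxa] := boolP (x <= a)%O; last first.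
    have e : (a \in upset x) = false by rewrite inE (negbTE nxa).
    by apply/matrixP=> -[i ia]; exfalso; move: ia; rewrite e.
  rewrite (M2 x a b) // !mulmxA; congr (_ *m _ *m _ *m _).
  have bU : b \in upset x by rewrite inE (le_trans xa).
  apply/matrixP=> i j; rewrite !mxE /= bU.
  by rewrite big_ord1 !mxE mulr1.
- exists (const_mx 1); rewrite M1 mulmx1 mulmxA -[RHS]mul1mx; congr (_ *m _).
  by apply/matrixP=> i j; rewrite !mxE /= inE lexx big_ord1 !mxE mulr1 !ord1.
move=> N f nf vf y.
have [xy|nxy] := boolP (x <= y)%O.
  by rewrite -!mulmxA nf // [v *m _]mulmxA vf mul0mx mulmx0.
have e : (y \in upset x) = false by rewrite inE (negbTE nxy).
by apply/matrixP=> -[i ia]; exfalso; move: ia; rewrite /= e.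
Qed.

Lemma approx_surj C M (f : homf C M) x (v : 'rV_(rdim M x)) :
  is_rep M -> approx f -> exists w, w *m f x = v.
Proof.
move=> rM af; have [u [nu [e eu] _]] := yoneda v rM.
have [h [nh hf]] := af _ u (add_spread K (upset_spread x)) nu.
by exists (e *m h x); rewrite -mulmxA hf.
Qed.

(** If the term of index 1 vanishes, the augmentation is bijective: by Yoneda a kernel element comes
    from that term, and every element of [M] is hit. If a later term vanishes, shift the resolution
    and augment it by the kernel. *)
Lemma spread_dim_dimle n M : is_rep M -> spread_dim_le M n -> dimle n M.
Proof.
move=> rM [R [rR [i [i_n z]]]]; apply: dimle_leq i_n _ => // {n}.
elim: i M rM R rR z => [|i IH] M rM R [aR [neR [ndR [z0 [zS [s0 [s1 sS]]]]]]] z.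
  have af : approx (sr_e R) by [].
  have fr x : row_free (sr_e R x).
    rewrite -kermx_eq0; apply/eqP/row_matrixP => j; rewrite row0.
    set v := row j _; have v0 : v *m sr_e R x = 0 by rewrite -row_mul mulmx_ker row0.
    have [u [nu [e eu] uf]] := yoneda v (add_is_rep (aR 0%N)); rewrite -eu.
    have [h [_ <-]] := s1 _ u (add_spread K (upset_spread x)) nu (uf _ _ neR v0).
    rewrite /compf [h x](_ : _ = 0) ?mul0mx ?mulmx0 //.
    by apply/matrixP=> a [b bz]; exfalso; move: bz; rewrite z.
  have [g [ng gf]] : lifts (sr_e R) (idf M).
    pose g x := pinvmx (sr_e R x).
    have gf x : g x *m sr_e R x = 1%:M.
      rewrite -[g x]mul1mx mulmxKpV //; apply/row_subP => j.
      by have [w <-] := approx_surj (row j 1%:M) rM af; apply: submxMl.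
    exists g; split=> // x y xy; apply: (row_free_inj (fr y)).
    by rewrite -[LHS]mulmxA gf mulmx1 -[RHS]mulmxA neR // mulmxA gf mul1mx.
  apply: add_retract rM _ (aR 0%N); exists g, (sr_e R); split=> //; split=> //.
have nk := ker_inc_natural neR; have kk := ker_inc_is_ker (sr_e R).
have [|e' [ne' ek]] := ker_lift nk kk (ndR 0%N); first by move=> x; apply: z0.
exists (sr_C R 0%N), (sr_e R), (ker_rep (sr_e R)), (ker_inc (sr_e R)).
split; split=> //.
have rL : is_rep (ker_rep (sr_e R)) by apply: sub_is_rep kk (add_is_rep (aR 0%N)).
have e0 Z (g : homf Z (sr_C R 1)) : zerof (compf g e') <-> zerof (compf g (sr_d R 0)).
  split=> g0 x; first by rewrite /compf -ek mulmxA; have := g0 x; rewrite /compf => ->; rewrite mul0mx.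
  by apply: (ker_inj (x := x) kk); rewrite -mulmxA ek mul0mx; apply: g0.
apply: (IH _ rL (@SpreadRes K _ P (ker_rep (sr_e R)) (fun i => sr_C R i.+1) e' (fun i => sr_d R i.+1))) => //.
split; first by move=> j; apply: aR.
split; first by [].
split; first by move=> j; apply: ndR.
split; first by apply/e0 => x; apply: zS.
split; first by move=> j; apply: zS.
split.
  move=> Z g aZ ng; have [||h [nh hd]] := s1 Z (compf g (ker_inc (sr_e R))) aZ.
  - exact: natural_comp.
  - by move=> x; rewrite /compf -mulmxA (ker_comp x kk) mulmx0.
  exists h; split=> // x; apply: (ker_inj (x := x) kk).
  by rewrite /compf /= -mulmxA ek; apply: hd.
split; first by move=> Z g aZ ng /e0; apply: sS.
by move=> j; apply: sS.
Qed.

(* [flat c] records a homomorphism from a spread as a point of a finite-dimensional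
   space which does not depend on the spread. *)
Definition maxdim N := \max_(x : P) rdim N x.
Definition flat V N (c : homf (spr V) N) : {ffun P -> 'rV[K]_(maxdim N)} :=
  [ffun x => (const_mx 1 : 'M_(1, rdim (spr V) x)) *m c x *m pid_mx (rdim N x)].

Lemma flatD V N (c d : homf (spr V) N) a :
  flat (fun x => c x - a *: d x) = flat c - a *: flat d.
Proof.
apply/ffunP=> x; rewrite !ffunE mulmxBr mulmxBl.
by rewrite -scalemxAr -scalemxAl.
Qed.

Lemma flat0 V N (c : homf (spr V) N) : flat c = 0 -> forall x, c x = 0.
Proof.
move=> /ffunP c0 x; have := c0 x; rewrite !ffunE => /(congr1 (mulmx^~ (pid_mx (rdim N x) : 'M_(_, rdim N x)))).
rewrite /= mul0mx -mulmxA pid_mx_id ?pid_mx_1; last exact: (leq_bigmax x).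
rewrite mulmx1 => e; apply/matrixP=> i j; have := congr1 (fun X : 'rV[K]_(rdim N x) => X ord0 j) e.
rewrite !mxE; move: (c x) i; rewrite /=; case: (x \in V) => [c' i|c' []//].
by rewrite big_ord1 mxE mul1r (ord1 i).
Qed.

(* The subspaces [A V] of homomorphisms known to factor through [g] grow with
   every step, and their dimensions are bounded. *)
Lemma extension_ind N (Phi : forall B, homf B N -> Prop) :
  (forall B (g : homf B N), natural g ->
    (forall V (c : homf (spr V) N), is_spread V -> natural c -> ~ lifts g c ->
      Phi (dsum (spr V) B) (colf c g)) -> Phi B g) ->
  forall B (g : homf B N), natural g -> Phi B g.
Proof.
move=> step; pose T := {ffun P -> 'rV[K]_(maxdim N)}.
have H n (A : {set P} -> {vspace T}) B (g : homf B N) :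
    (\sum_V (\dim {:T} - \dim (A V)) < n)%N -> natural g ->
    (forall V (c : homf (spr V) N), natural c -> flat c \in A V -> lifts g c) ->
    Phi B g.
  elim: n A B g => // n IH A B g An ng HA; apply: step => // V c sV nc nlift.
  pose A' U := if U == V then (A U + <[flat c]>)%VS else A U.
  have cA : flat c \notin A V by apply/negP=> /(HA V c nc).
  apply: (IH A'); last 1 first.
  - move=> U d nd; rewrite /A'; case: eqP => [UV|_]; last first.
      by move=> /(HA U d nd); apply: lifts_inr.
    subst U; case/memv_addP => a aA [b /vlineP[l ->] e].
    (* The map [d - l c] has its flat image in the old subspace and lifts through [g]; [l c] lifts
       through the new summand. *)
    apply: (@lifts_ext _ _ _ _ _ _ _ (sumf (fun x => d x - l *: c x) (fun x => l *: c x))).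
      by move=> x; rewrite /sumf subrK.
    apply: lifts_add; last first.
      apply/lifts_inl/lifts_scale; exists (idf _); split; first exact: natural_id.
      by move=> x; rewrite mul1mx.
    apply: lifts_inr; apply: HA; last by rewrite flatD e addrK.
    exact/(natural_add nd)/natural_opp/natural_scale.
  - rewrite ltnS in An; apply: leq_trans An.
    have dV : (\dim (A V) < \dim (A' V) <= \dim {:T})%N.
      rewrite /A' eqxx dimvS ?subvf // andbT ltnNge; apply/negP=> le.
      have : (A V + <[flat c]> <= A V)%VS.
        by have := dimv_leqif_sup (addvSl (A V) <[flat c]>%VS) => -[_ <-]; rewrite eqn_leq le dimvS ?addvSl.
      by rewrite subv_add => /andP[_]; rewrite -memvE (negbTE cA).
    rewrite [X in (_ < X)%N](bigD1 V) //= [X in (X < _)%N](bigD1 V) //=.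
    rewrite -addSn leq_add //; last by apply: leq_sum => U /negbTE UV; rewrite /A' UV.
    by case/andP: dV => d1 d2; apply: ltn_sub2l (leq_trans d1 d2) d1.
  - exact: natural_col.
move=> B g ng; apply: (H _ (fun _ => 0%VS) B g (ltnSn _)) => // V c nc.
rewrite memv0 => /eqP/flat0 c0; apply: lifts_ext (lifts_null _ g) => x.
by rewrite c0.
Qed.

(** As long as some map from a member of [DD] does not factor, adjoin it as a new summand;
    [extension_ind] makes this stop. *)
Lemma right_approx (DD : {set P} -> Prop) N : (forall V, DD V -> is_spread V) ->
  exists Ss (f : homf (spreads K Ss) N),
    [/\ forall V, V \in Ss -> DD V, natural f &
        forall V (c : homf (spr V) N), DD V -> natural c -> lifts f c].
Proof.
move=> DDs.
(* The equation keeps track of the list of spreads summed so far. *)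
have H := @extension_ind N (fun B g => forall Ss (e : B = spreads K Ss),
  (forall V, V \in Ss -> DD V) -> exists Ss' (f : homf (spreads K Ss') N),
    [/\ forall V, V \in Ss' -> DD V, natural f &
        forall V (c : homf (spr V) N), DD V -> natural c -> lifts f c]).
apply: (H _ (zero_rep K P) (nullf _ _) (@natural_null _ _ _ _ _) [::]) => // {H} B g ng IH Ss eB Sd.
have [[V [c [dV nc nl]]]|none] := classic (exists V (c : homf (spr V) N),
  [/\ DD V, natural c & ~ lifts g c]); last first.
  subst B; exists Ss, g; split=> // V c dV nc; apply: NNPP => nl.
  by apply: none; exists V, c.
apply: (IH V c (DDs _ dV) nc nl (V :: Ss)); first by rewrite eB.
by move=> U; rewrite inE => /orP[/eqP->|/Sd].
Qed.

Lemma approx_exists N :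
  exists C (f : homf C N), [/\ in_add_spread C, natural f & approx f].
Proof.
have [Ss [f [Sp nf H]]] := @right_approx (@is_spread _ P) N (fun _ => id).
exists (spreads K Ss), f; split=> //; first exact: add_spreads.
by apply: approx_spreads.
Qed.

End Resolutions.

(** * Almost split maps and devissage *)

Section Devissage.
Local Open Scope ring_scope.
Variables (K : fieldType) (disp : Order.disp_t) (P : finPOrderType disp).
Implicit Types A B C D L M N Z W : rep K P.
Implicit Types S U V X : {set P}.
Local Notation spr S := (spread_rep K S).

Definition downset (x : P) : {set P} := [set y | (y <= x)%O].

Lemma downset_spread x : is_spread (downset x).
Proof.
split; first by apply/set0Pn; exists x; rewrite inE.
split; first by move=> s y s'; rewrite !inE => _ s'x _ ys'; apply: le_trans s'x.
have st y : y \in downset x -> connect (spread_rel (downset x)) x y.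
  by rewrite inE => yx; apply: connect1; rewrite /spread_rel !inE lexx yx orbT.
by move=> y z /st xy /st; apply: connect_trans; rewrite spread_rel_sym.
Qed.

(** Dual to [yoneda]: a linear form on [B] at [x] is a map to the injective carried by [downset x].
    Each column of [F] contributes one such summand. *)
Lemma coseparate_at M B (i : homf M B) x d (F : 'M_(rdim B x, d)) :
  is_rep B -> natural i -> i x *m F = 0 ->
  exists C (g : homf B C), [/\ in_add_spread C, natural g, (forall y, i y *m g y = 0) &
    forall m (v : 'M_(m, _)), v *m g x = 0 -> v *m F = 0].
Proof.
move=> [B1 B2] ni; elim: d F => [|d IH] F iF.
  exists (zero_rep K P), (nullf _ _); split; try by [exact: add_zero|exact: natural_null].
    by move=> y; rewrite mulmx0.
  by move=> m v _; apply/matrixP=> a [].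
pose F1 : 'cV_(rdim B x) := lsubmx (F : 'M_(_, 1 + d)).
pose F2 : 'M_(rdim B x, d) := rsubmx (F : 'M_(_, 1 + d)).
have FE : F = row_mx F1 F2 by rewrite hsubmxK.
have [iF1 iF2] : i x *m F1 = 0 /\ i x *m F2 = 0.
  by apply: eq_row_mx; rewrite -mul_mx_row -FE iF row_mx0.
have [C [g [aC ng ig gF]]] := IH F2 iF2.
pose h : homf B (spr (downset x)) := fun y => rmap B y x *m F1 *m const_mx 1.
have out y : ~~ (y <= x)%O -> forall m (u v : 'M[K]_(m, rdim (spr (downset x)) y)), u = v.
  move=> yx m u v; apply/matrixP => a [b bb]; exfalso; move: bb.
  by rewrite /= inE (negbTE yx).
exists (dsum (spr (downset x)) C), (rowf h g); split.
- exact/(add_dsum _ aC)/add_spread/downset_spread.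
- apply: natural_row => // a b ab.
  have [bx|nbx] := boolP (b <= x)%O; last exact: out.
  have ax : a \in downset x by rewrite inE (le_trans ab).
  rewrite /h !mulmxA -B2 // -!mulmxA; congr (_ *m (_ *m _)).
  by apply/matrixP => s t; rewrite !mxE /= ax big_ord1 !mxE mulr1.
- move=> y; rewrite /rowf mul_mx_row ig /h.
  have [yx|nyx] := boolP (y <= x)%O; last by rewrite (out _ nyx _ (_ *m _) 0) row_mx0.
  by rewrite !mulmxA -ni // -(mulmxA _ (i x)) iF1 mulmx0 mul0mx row_mx0.
move=> m v; rewrite /rowf mul_mx_row -[0 in X in X -> _]row_mx0 => /eq_row_mx[vh vg].
rewrite FE [LHS](mul_mx_row v F1 F2) (gF _ _ vg) (_ : v *m F1 = 0) ?row_mx0 //.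
have := congr1 (mulmx^~ (const_mx 1 : 'cV_(rdim (spr (downset x)) x))) vh.
rewrite /= mul0mx /h B1 mul1mx -!mulmxA => e.
rewrite -{}e; congr (_ *m _); rewrite -[LHS]mulmx1; congr (_ *m _).
by apply/matrixP=> s t; rewrite !mxE /= inE lexx big_ord1 !mxE mulr1 !ord1.
Qed.

(** The cokernel of [i] embeds into a sum of injectives: at each point take the linear forms given
    by the cokernel matrix of [i x]. *)
Lemma coseparate M B (i : homf M B) : is_rep B -> natural i ->
  exists C (g : homf B C), [/\ in_add_spread C, natural g, (forall x, i x *m g x = 0) &
    forall x m (v : 'M_(m, _)), v *m g x = 0 -> exists w, v = w *m i x].
Proof.
move=> rB ni.
have [C [g [aC ng ig H]]] : exists C (g : homf B C),
   [/\ in_add_spread C, natural g, (forall x, i x *m g x = 0) &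
    forall x, x \in enum P -> forall m (v : 'M_(m, _)), v *m g x = 0 -> exists w, v = w *m i x].
  elim: (enum P) => [|x xs [C [g [aC ng ig H]]]].
    exists (zero_rep K P), (nullf _ _); split=> // [||y]; last by rewrite mulmx0.
      exact: add_zero.
    exact: natural_null.
  have [C' [g' [aC' ng' ig' H']]] := coseparate_at rB ni (mulmx_coker (i x)).
  exists (dsum C' C), (rowf g' g); split.
  - exact: add_dsum.
  - exact: natural_row.
  - by move=> y; rewrite /rowf mul_mx_row ig ig' row_mx0.
  move=> y; rewrite inE => yx m v; rewrite /rowf mul_mx_row -[0 in X in X -> _]row_mx0.
  case/eq_row_mx => v' v0; case/predU1P: yx => [yx|yx]; last exact: (H y).
  subst y; by apply/submxP; rewrite submxE; apply/eqP/H'.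
by exists C, g; split=> // x; apply: H; rewrite mem_enum.
Qed.

(** For a spread [S] the endomorphisms of [spr S] are scalars, so the last clause says that the
    identity does not lift. Thus coker Hom(-, rho) is the simple functor at [spr S]. *)
Definition almost_split S C (rho : homf C (spr S)) : Prop :=
  [/\ in_add_spread C, natural rho,
      forall V (u : homf (spr V) (spr S)), is_spread V -> V <> S -> natural u -> lifts rho u &
      forall u : homf (spr S) C, natural u -> forall x, u x *m rho x = 0].

(** This is the condition called [n]-good above. *)
Definition simple_le n S : Prop :=
  exists C (rho : homf C (spr S)) L (k : homf L C),
    almost_split rho /\ [/\ natural k, is_ker k rho & dimle n L].

Lemma simple_leq n m S : (n <= m)%N -> simple_le n S -> simple_le m S.
Proof.
move=> nm [C [rho [L [k [as_ [nk kk dL]]]]]]; exists C, rho, L, k; split=> //; split=> //.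
by apply: dimle_leq nm dL; case: as_ => aC _ _ _; apply: sub_is_rep kk (add_is_rep aC).
Qed.

Lemma endo_null S V (a : homf (spr S) (spr V)) (b : homf (spr V) (spr S)) :
  is_spread S -> is_spread V -> V <> S -> natural a -> natural b -> forall x, a x *m b x = 0.
Proof.
move=> [_ [_ cS]] [_ [_ cV]] VS na nb x.
pose mS y := y \in S; pose mV y := y \in V.
apply/eqP; rewrite -(@ev_eq0 _ _ _ mS mS (compf a b)); apply/negPn/negP.
rewrite (@ev_comp _ _ _ mS mV mS) mulf_eq0 negb_or => /andP[a0 b0].
by apply: VS; apply: spread_antisym cS cV nb na b0 a0.
Qed.

(** Approximate [spr S] by the spreads other than [S]; an endomorphism of [spr S] through another
    spread is zero. *)
Lemma almost_split_exists S : is_spread S ->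
  exists C (rho : homf C (spr S)), almost_split rho.
Proof.
move=> sS; have [V []//|Ss [f [Sd nf H]]] := @right_approx K _ P (fun V => is_spread V /\ V <> S) (spr S).
have Sp V : V \in Ss -> is_spread V by move=> /Sd[].
exists (spreads K Ss), f; split=> //; first exact: add_spreads.
  by move=> V u sV VS nu; apply: H.
move=> u nu; apply: spreads_null => // V a b /Sd[sV VS]; exact: endo_null.
Qed.

Lemma endo_scalar S (q : homf (spr S) (spr S)) x0 : connected_set S -> natural q ->
  x0 \in S -> forall x, q x = ev q x0 *: 1%:M.
Proof.
move=> cS nq x0S x; pose m y := y \in S.
have nid : natural (fun x => ev q x0 *: 1%:M : 'M_(rdim (spr S) x)).
  by apply: natural_scale; apply: natural_id.
apply: (@ev_inj K _ P m m q (fun x => ev q x0 *: 1%:M)).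
rewrite [RHS]mxsZ -/(ev (idf (ind K m)) x).
have [xS|nxS] := boolP (m x); last first.
  have z f : @ev K _ P (ind K m) (ind K m) f x = 0.
    by apply/eqP/negPn/negP => /(@ev_neq0 _ _ _ m m)[]; rewrite (negbTE nxS).
  by rewrite !z mulr0.
by rewrite ev_idf // mulr1; apply: (@ev_connected _ _ _ S m).
Qed.

(* The functor coker Hom(-, g) has a simple subfunctor, generated by some c : k_S -> C
   not factoring through g; adding it to g replaces ker g by M' and gives a
   spread-exact sequence 0 -> ker rho -> M + C_S -> M' -> 0. *)
Lemma devissage (DD : {set P} -> Prop) n C :
  (forall S, is_spread S -> DD S -> simple_le n S) -> in_add_spread C ->
  forall B (g : homf B C), natural g -> in_add_spread B ->
  (forall S (c : homf (spr S) C), is_spread S -> ~ DD S -> natural c -> lifts g c) ->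
  forall M (i : homf M B), natural i -> is_ker i g -> dimle n M.
Proof.
move=> simp aC; apply: extension_ind => B g ng IH aB supp M i ni ki.
have rM : is_rep M by apply: sub_is_rep ki (add_is_rep aB).
(* When every map from a spread lifts, [g] is a split epimorphism and [M] is a summand of [B]. *)
have [[V0 [c0 [sV0 nc0 nl0]]]|none] := classic (exists V (c : homf (spr V) C),
  [/\ is_spread V, natural c & ~ lifts g c]); last first.
  have [|s [ns sg]] := @approx_spreads _ _ _ _ _ g _ C (idf C) aC (@natural_id _ _ _ _).
    by move=> V u sV nu; apply: NNPP => nl; apply: none; exists V, u.
  apply: (@dimle_leq _ _ _ 0) => //=.
  have [||t [nt ti]] := @ker_lift _ _ _ _ _ _ _ _ g (sumf (idf B) (negf (compf g s))) ni ki.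
  - by apply: natural_add; [apply: natural_id|apply/natural_opp/natural_comp].
  - by move=> x; rewrite /sumf /negf /compf mulmxDl mulNmx -mulmxA sg mulmx1 mul1mx subrr.
  apply: add_retract rM _ aB; exists i, t; split=> //; split=> // x.
  apply: (ker_inj (x := x) ki); rewrite -mulmxA ti /sumf /negf /compf.
  by rewrite mulmxDr mulmxN mulmxA (ker_comp x ki) mul0mx subr0 mulmx1 mul1mx.
(* Precompose a non-lifting map with maps from other spreads while it stays non-lifting. No spread
   recurs, as the composite of two such maps back to the same spread is zero. The final [c]
   generates a simple subfunctor of coker Hom(-, g). *)
have [S [c [[sS nc nl] good]]] : exists S (c : homf (spr S) C),
    [/\ is_spread S, natural c & ~ lifts g c] /\
    forall V (u : homf (spr V) (spr S)), is_spread V -> V <> S -> natural u -> lifts g (compf u c).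
  pose T := {V : {set P} & homf (spr V) C}.
  pose bad (a : T) := [/\ is_spread (tag a), natural (tagged a) & ~ lifts g (tagged a)].
  pose R (a b : T) := [/\ bad a, bad b, tag a <> tag b &
    exists u : homf (spr (tag a)) (spr (tag b)), natural u /\
      forall x, u x *m tagged b x = tagged a x].
  have [||[S c] [Sc mS]] := @label_descent {set P} T (@tag _ _) R (Tagged (fun V => homf (spr V) C) c0).
  - move=> [V1 c1] [V2 c2] [V3 c3] [b1 b2 n12 [u [nu uE]]] [_ b3 n23 [w [nw wE]]].
    rewrite /= in n12 n23 u nu uE w nw wE; split=> //=; last first.
      by exists (compf u w); split; [apply: natural_comp|move=> x; rewrite /compf -mulmxA wE].
    move=> e; subst V3; case: b1 => /= s1 _; apply; apply: lifts_ext (lifts_null _ g) => x.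
    case: b2 => s2 _ _.
    by rewrite -uE -wE mulmxA (@endo_null V1 V2 u w) ?mul0mx // => e; apply: n12.
  - by move=> a b [].
  have [sS nc nl] : bad (existT (fun V => homf (spr V) C) S c) by case: Sc => [->|[]].
  exists S, c; split=> // V u sV VS nu; apply: NNPP => nlu.
  apply: (mS (Tagged (fun V => homf (spr V) C) (compf u c))); split=> //.
    by split=> //; apply: natural_comp.
  by exists u.
have DS : DD S by apply: NNPP => nD; apply: nl; apply: supp.
have [CS [rho [KS [k [[aCS nrho rsplit rnull] [nk kk dKS]]]]]] := simp S sS DS.
(* On the spread [S] itself the composite with [rho] is zero; on all others the choice of [c]
   applies. *)
have [l [nll lg]] : lifts g (compf rho c).
  apply: add_lifts aCS (natural_comp nrho nc) _ => V u sV nu.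
  have [VS|VS] := classic (V = S).
    subst V; apply: lifts_ext (lifts_null _ g) => x.
    by rewrite /compf mulmxA rnull // mul0mx.
  apply: lifts_ext (good V (compf u rho) sV VS (natural_comp nu nrho)) => x.
  by rewrite /compf mulmxA.
set G := colf c g; have nG : natural G by apply: natural_col.
set M' := ker_rep G; have ni' := ker_inc_natural nG; have ki' := ker_inc_is_ker G.
have dM' : dimle n M'.
  apply: (IH S c sS nc nl _ _ _ (ker_inc G)) => //; first exact/add_dsum/aB/add_spread.
  by move=> V d sV nD nd; apply: lifts_inr; apply: supp.
have nn A' B' : natural (@nullf K _ P A' B') by apply: natural_null.
(* The map sends [(a, b)] to [(b rho, a i - b l)], which [G] kills because [rho c = l g]. *)
have [||e [ne ei]] := @ker_lift _ _ _ _ _ _ _ _ G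
   (colf (rowf (nullf _ _) i) (rowf rho (negf l))) ni' ki'.
- by apply: natural_col; apply: natural_row => //; apply: natural_opp.
- move=> x; rewrite /colf mul_col_mx /rowf /G /colf !mul_row_col mul0mx add0r.
  rewrite (ker_comp x ki) /negf mulNmx; have := lg x; rewrite /compf => ->.
  by rewrite subrr col_mx0.
have eE x m (a : 'M_(m, _)) (b : 'M_(m, _)) : row_mx a b *m e x *m ker_inc G x =
    row_mx (b *m rho x) (a *m i x - b *m l x).
  rewrite -mulmxA ei /colf mul_row_col /rowf !mul_mx_row mulmx0 add_row_mx add0r.
  by rewrite /negf mulmxN.
have [||mm [nmm mi]] := @ker_lift _ _ _ _ _ _ _ i g (compf k l) ni ki.
- exact: natural_comp.
- move=> x; rewrite /compf -mulmxA; have := lg x; rewrite /compf => ->.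
  by rewrite mulmxA (ker_comp x kk) mul0mx.
have kke : is_ker (rowf mm k) e.
  apply: is_kerI => x.
  - move=> m v; rewrite /rowf mul_mx_row -[0 in X in X -> _]row_mx0 => /eq_row_mx[_ vk].
    by apply: (ker_inj (x := x) kk); rewrite vk mul0mx.
  - apply: (ker_inj (x := x) ki'); rewrite /rowf eE mul0mx (ker_comp x kk) mi /compf subrr.
    by rewrite row_mx0.
  move=> m v; rewrite -[v]hsubmxK; set a := lsubmx v; set b := rsubmx v => ve.
  have := eE x m a b; rewrite ve mul0mx -row_mx0 => /eq_row_mx[/esym br /esym ab].
  have [w bw] := ker_ex kk br; exists w; rewrite /rowf mul_mx_row -bw; congr row_mx.
  apply: (ker_inj (x := x) ki); rewrite -mulmxA mi /compf mulmxA -bw.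
  by apply/eqP; rewrite -subr_eq0; apply/eqP.
have ape : approx e.
  apply: approx_spreads => V u sV nu.
  have nui := natural_comp nu ni'.
  have [nq nr] := natural_restrict_row nui.
  set q := fun x : P => _ in nq; set r := fun x : P => _ in nr.
  have uE x : u x *m ker_inc G x = row_mx (q x) (r x) by rewrite hsubmxK.
  have qr x : q x *m c x + r x *m g x = 0.
    by rewrite -mul_row_col -uE -(mulmxA (u x)) [X in _ *m X](ker_comp x ki') mulmx0.
  (* If [V = S] then [q] is a scalar with [q c + r g = 0]. A nonzero scalar could be inverted, and
     [c] would lift through [g]. *)
  have [y [ny yrho]] : lifts rho q.
    have [VS|VS] := classic (V = S); last exact: rsplit.
    subst V; apply: lifts_ext (lifts_null _ rho) => x.
    apply/esym/eqP; rewrite -(@ev_eq0 _ _ _ (fun y => y \in S) (fun y => y \in S) q).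
    apply/negPn/negP => q0; apply: nl.
    have [xS _] := @ev_neq0 _ _ _ (fun y => y \in S) (fun y => y \in S) q x q0.
    have cS : connected_set S by case: sS => _ [].
    apply: (@lifts_ext _ _ _ _ _ _ g (fun z => (- (ev q x)^-1) *: (r z *m g z))).
      move=> z; have /eqP := qr z; rewrite addrC addr_eq0 => /eqP->.
      rewrite (endo_scalar cS nq xS z) -scalemxAl mul1mx scalerN scalerA mulNr.
      by rewrite mulVf // scaleNr opprK scale1r.
    by apply: lifts_scale; exists r.
  have [||a [na ai]] := @ker_lift _ _ _ _ _ _ _ i g (sumf r (compf y l)) ni ki.
  - by apply: natural_add => //; apply: natural_comp.
  - move=> x; rewrite /sumf /compf mulmxDl -mulmxA; have := lg x; rewrite /compf => ->.
    by rewrite mulmxA yrho addrC qr.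
  exists (rowf a y); split; first exact: natural_row.
  move=> x; apply: (ker_inj (x := x) ki').
  by rewrite /rowf eE yrho ai /sumf /compf addrK uE.
(* The extension bounds [M] plus [CS] by ker rho and [M']; the summand [CS] is then cancelled. *)
apply: (dimle_summand rM aCS).
apply: (dimle_ext _ _ ne kke ape) => //; first exact: dsum_is_rep rM (add_is_rep aCS).
exact: natural_row.
Qed.

Lemma dimle_simples n : (forall S, is_spread S -> simple_le n S) ->
  forall M, is_rep M -> dimle n M.
Proof.
move=> simp M rM.
have [I0 [g [a0 ng _ gM]]] := coseparate rM (@natural_null _ _ _ (zero_rep K P) M).
have [I1 [h [a1 nh gh hI]]] := coseparate (add_is_rep a0) ng.
apply: (@devissage (fun _ => True) n I1 _ a1 _ h nh a0 _ M g ng) => //.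
  by move=> S sS _; apply: simp.
apply: is_kerI => x //; last exact: hI.
by move=> m v /gM[w ->]; rewrite mulmx0.
Qed.

End Devissage.

(** * Finiteness for a fixed poset *)

Section Finiteness.
Local Open Scope ring_scope.
Variables (K : fieldType) (disp : Order.disp_t) (P : finPOrderType disp).
Implicit Types A B C D L M N Z W : rep K P.
Implicit Types S U V X : {set P}.
Local Notation spr S := (spread_rep K S).

(** An up-set of [X], so it carries a subrepresentation of [spr X]. *)
Definition cut_below X p : {set P} := [set x in X | ~~ (x <= p)%O].

Definition cut_inc X p : homf (spr (cut_below X p)) (spr X) :=
  indf (fun x => x \in cut_below X p) (fun x => x \in X) (fun _ => 1).

Lemma cut_inc_natural X p : natural (cut_inc X p).
Proof.
apply: indf_natural => x y xy; rewrite !inE => /andP[-> xp] yX; rewrite yX.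
by rewrite (_ : ~~ (y <= p)%O) //; apply: contra xp; apply: le_trans.
Qed.

Lemma cut_inc_inj X p x m (v : 'M_(m, rdim (spr (cut_below X p)) x)) :
  v *m cut_inc X p x = 0 -> v = 0.
Proof.
have [xU|nxU] := boolP (x \in cut_below X p); last first.
  move=> _; apply/matrixP=> a [b bb]; exfalso; move: bb.
  by rewrite /= (negbTE nxU).
have xX : x \in X by move: xU; rewrite inE => /andP[].
move=> v0; rewrite -[v]mulmx1.
have <- : cut_inc X p x *m (const_mx 1 : 'M_(rdim (spr X) x, rdim (spr (cut_below X p)) x)) = 1%:M.
  apply/matrixP=> a b; rewrite !mxE (eq_bigr (fun=> 1)) => [|j _]; last by rewrite !mxE mulr1.
  rewrite /= xX big_ord1.
  by move: a b; rewrite /= xU => a b; rewrite !ord1.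
by rewrite mulmxA v0 mul0mx.
Qed.

(** By naturality, vanishing at [p] spreads to every point of [V] below [p]. *)
Lemma cut_inc_lifts X p V (u : homf (spr V) (spr X)) : natural u -> p \in X ->
  ev u p = 0 -> lifts (cut_inc X p) u.
Proof.
move=> nu pX up; pose mV y := y \in V; pose mX y := y \in X.
pose mU y := y \in cut_below X p.
have un x y : (x <= y)%O -> x \in V -> y \in X -> ev u x = ev u y.
  exact: (@ev_natural _ _ _ mV mX).
have u_neq x : ev u x != 0 -> x \in V /\ x \in X by apply: (@ev_neq0 _ _ _ mV mX).
have u_out x : ~~ (x \in cut_below X p) -> ev u x = 0.
  rewrite inE negb_and negbK => H; apply/eqP/negPn/negP => u0.
  have [xV xX] := u_neq x u0; move: H; rewrite xX /= => xp.
  by rewrite (un x p xp xV pX) up eqxx in u0.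
exists (indf mV mU (ev u)); split.
  apply: indf_natural => x y xy xV yU.
  have yX : y \in X by move: yU; rewrite /mU inE => /andP[].
  have -> : (if mV y then ev u y else 0) = ev u y.
    by case: ifP => // nyV; apply/esym/eqP/negPn/negP => /u_neq[yV]; rewrite -[y \in V]/(mV y) nyV in yV.
  rewrite -(un x y xy xV yX) /mX; case: ifP => // nxX.
  by apply/u_out; rewrite nxX.
move=> x; apply: (@ev_inj K _ P mV mX (compf (indf mV mU (ev u)) (cut_inc X p)) u).
rewrite (@ev_comp _ _ _ mV mU mX) ev_indf /cut_inc (@ev_indf _ _ _ mU mX).
have [xU|nxU] := boolP (mU x); last by rewrite andbF mul0r (u_out x).
have xX : mX x by move: xU; rewrite /mU inE => /andP[].
rewrite xX mulr1 andbT; case: ifP => // nxV; apply/esym/eqP/negPn/negP => /u_neq[].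
by rewrite -[x \in V]/(mV x) nxV.
Qed.

Lemma cut_below_convex X p : convex X -> convex (cut_below X p).
Proof.
move=> cX s y s'; rewrite !inE => /andP[sX sp] /andP[s'X _] sy ys'.
rewrite (cX s y s') //=; by apply: contra sp; apply: le_trans.
Qed.

(** Approximate ker rho by [d] and lift the inclusion [j] of [cut_below X p] along [rho]. The map
    [g] joining both has the same kernel as [d], since [j] is injective. A map from a spread in [Y]
    to [C] lifts through [g], because after [rho] it vanishes at [p] and so factors through [j].
    Devissage thus needs only spreads outside [Y], and passing from ker d to ker rho costs one. *)
Lemma simple_step (Y : {set {set P}}) n X p :
  (forall S, is_spread S -> S \notin Y -> simple_le K n S) -> is_spread X -> p \in X ->
  (forall V (u : homf (spr V) (spr X)), is_spread V -> V \in Y -> V <> X -> natural u ->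
     ev u p = 0) ->
  simple_le K n.+1 X.
Proof.
move=> simp sX pX mX.
have [C [rho as_]] := almost_split_exists K sX; case: (as_) => aC nrho rsplit rnull.
have nk := ker_inc_natural nrho; have kk := ker_inc_is_ker rho.
exists C, rho, (ker_rep rho), (ker_inc rho); split=> //; split=> //.
have [C1 [d [a1 nd ad]]] := approx_exists (ker_rep rho).
have nk1 := ker_inc_natural nd; have kk1 := ker_inc_is_ker d.
exists C1, d, (ker_rep d), (ker_inc d); split; split=> //.
set U := cut_below X p; pose j : homf (spr U) (spr X) := cut_inc X p.
have nj : natural j by apply: cut_inc_natural.
have pU : p \notin U by rewrite inE lexx andbF.
have aU : in_add_spread (spr U).
  by apply/add_set/cut_below_convex; case: sX => _ [].
have cX : connected_set X by case: sX => _ [].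
(* An endomorphism of [spr X] that factors through [j] is a scalar vanishing at [p], hence zero. *)
have [jt [njt jtr]] : lifts rho j.
  apply: add_lifts => // V u sV nu.
  have [VX|VX] := classic (V = X); last exact/rsplit/natural_comp.
  subst V; apply: lifts_ext (lifts_null _ rho) => x.
  rewrite (endo_scalar cX (natural_comp nu nj) pX).
  rewrite (@ev_comp _ _ _ (fun x => x \in X) (fun x => x \in U) (fun x => x \in X)).
  rewrite (_ : ev u p = 0) ?mul0r ?scale0r //; apply/eqP/negPn/negP.
  by move/(@ev_neq0 _ _ _ (fun x => x \in X) (fun x => x \in U)) => []; rewrite (negbTE pU).
pose g := colf jt (compf d (ker_inc rho)).
have ng : natural g by apply: natural_col => //; apply: natural_comp.
apply: (@devissage _ _ _ (fun S => S \notin Y) n C simp aC _ g ng (add_dsum aU a1) _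
   _ (rowf (nullf _ _) (ker_inc d))).
- move=> V c sV /negP; rewrite negbK => VY nc.
  have [c' [nc' cj]] : lifts j (compf c rho).
    have [VX|VX] := classic (V = X).
      subst V; apply: lifts_ext (lifts_null _ j) => x.
      by rewrite /compf rnull.
    by apply: cut_inc_lifts => //; [apply: natural_comp|apply: mX => //; apply: natural_comp].
  have [||z [nz zk]] := @ker_lift _ _ _ _ _ _ _ _ rho (sumf c (negf (compf c' jt))) nk kk.
  - by apply/natural_add/natural_opp/natural_comp.
  - move=> x; rewrite /sumf /negf /compf mulmxDl mulNmx -mulmxA jtr; have := cj x.
    by rewrite /compf => ->; rewrite subrr.
  have [y [ny yd]] := ad _ z (add_spread K sV) nz.
  exists (rowf c' y); split; first exact: natural_row.
  move=> x; rewrite /rowf /g /colf mul_row_col /compf mulmxA yd zk /sumf /negf /compf.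
  by rewrite addrC subrK.
- by apply: natural_row => //; apply: natural_null.
apply: is_kerI => x.
- move=> m v; rewrite /rowf mul_mx_row -[0 in X in X -> _]row_mx0 => /eq_row_mx[_ vk].
  by apply: (ker_inj (x := x) kk1); rewrite vk mul0mx.
- by rewrite /rowf /g /colf mul_row_col mul0mx add0r /compf mulmxA (ker_comp x kk1) mul0mx.
move=> m v; rewrite -[v]hsubmxK; set a := lsubmx v; set b := rsubmx v.
rewrite /g /colf mul_row_col /compf => e.
have a0 : a = 0.
  apply: (@cut_inc_inj X p x); rewrite -[cut_inc X p x]/(j x) -jtr.
  have := congr1 (mulmx^~ (rho x)) e.
  rewrite /= mulmxDl mul0mx -(mulmxA a) -(mulmxA b) -(mulmxA (d x)) (ker_comp x kk).
  by rewrite !mulmx0 addr0.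
have [w bw] : exists w, b = w *m ker_inc d x.
  apply: (ker_ex kk1); apply: (ker_inj (x := x) kk).
  by rewrite mul0mx -mulmxA -[RHS]e a0 mul0mx add0r.
by exists w; rewrite /rowf mul_mx_row mulmx0 a0 bw.
Qed.

(** [Y] holds the sets still to be treated, at first all of them; removing one spread raises the
    bound by one. *)
Lemma simples_bounded : exists n, forall S, is_spread S -> simple_le K n S.
Proof.
suff H m (Y : {set {set P}}) n : (#|Y| <= m)%N ->
    (forall S, is_spread S -> S \notin Y -> simple_le K n S) ->
    exists n, forall S, is_spread S -> simple_le K n S.
  by apply: (H _ setT 0%N (leqnn _)) => S _; rewrite inE.
elim: m Y n => [|m IH] Y n.
  by rewrite leqn0 cards_eq0 => /eqP-> simp; exists n => S sS; apply: simp; rewrite ?inE.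
move=> Ym simp; have [Y0|[X0 X0Y]] := set_0Vmem Y.
  by exists n => S sS; apply: simp; rewrite // Y0 inE.
have del X : X \in Y -> (#|Y :\ X| <= m)%N.
  by move=> XY; rewrite (cardsD1 X) XY in Ym.
have [[X [XY nX]]|allS] := classic (exists X, X \in Y /\ ~ is_spread X).
  apply: (IH (Y :\ X) n (del X XY)) => S sS; rewrite !inE negb_and negbK.
  by case/orP => [/eqP e|]; [rewrite e in sS|apply: simp].
have {allS} Ys X : X \in Y -> is_spread X.
  by move=> XY; apply: NNPP => nX; apply: allS; exists X.
have [X0ne _] := Ys X0 X0Y; have [p pX0] := set0Pn _ X0ne.
(* Being nonzero at the fixed point [p] is stable under composition, and antisymmetry excludes
   cycles. A minimal [X] receives only maps vanishing at [p] from the other members of [Y]. *)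
pose R V X := [/\ V \in Y, X \in Y, V <> X &
  exists u : homf (spr V) (spr X), natural u /\ ev u p != 0].
have [||X [XX0 minX]] := @label_descent {set P} {set P} id R X0.
- move=> V1 V2 V3 [Y1 Y2 n12 [u [nu u0]]] [_ Y3 n23 [w [nw w0]]]; split=> //; last first.
    exists (compf u w); split; first exact: natural_comp.
    by rewrite (@ev_comp _ _ _ (fun x => x \in V1) (fun x => x \in V2) (fun x => x \in V3)) mulf_neq0.
  move=> e; subst V3; apply: n12.
  have [_ [_ c1]] := Ys V1 Y1; have [_ [_ c2]] := Ys V2 Y2.
  exact: spread_antisym c2 c1 nu nw u0 w0.
- by move=> V X [].
have [XY pX] : X \in Y /\ p \in X.
  case: XX0 => [->//|[XY _ _ [u [_ u0]]]]; split=> //.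
  by case: (@ev_neq0 _ _ _ (fun x => x \in X) (fun x => x \in X0) u p u0).
have sX := Ys X XY.
apply: (IH (Y :\ X) n.+1 (del X XY)) => S sS; rewrite !inE negb_and negbK.
case/orP => [/eqP->|SY]; last exact/simple_leq/simp.
apply: simple_step simp sX pX _ => V u sV VY VX nu; apply/eqP/negPn/negP => u0.
by apply: (minX V); split=> //; exists u.
Qed.

End Finiteness.

(** * Pullback along an adjunction *)

Section Pullback.
Local Open Scope ring_scope.
Variables (K : fieldType).

Definition pull (T T' : Type) (f : T -> T') (M : rep K T') : rep K T :=
  @Rep K T (fun x => rdim M (f x)) (fun x y => rmap M (f x) (f y)).

Definition pullf (T T' : Type) (f : T -> T') (M N : rep K T') (h : homf M N) :
  homf (pull f M) (pull f N) := fun x => h (f x).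

(** Preimages of convex sets under a monotone map are convex; they may be disconnected, which
    [add_ind] accounts for. *)
Lemma pull_add d d' (P : finPOrderType d) (P' : finPOrderType d') (f : P -> P') Z :
  (forall x y, x <= y -> f x <= f y)%O -> in_add_spread Z -> in_add_spread (pull f Z).
Proof.
move=> mf [[Z1 Z2] [Ss [sp [s [r [ns [nr sr]]]]]]].
have aS : in_add_spread (pull f (spreads K Ss)).
  elim: Ss sp {s r ns nr sr} => [|S Ss IH] sp; first exact: (add_zero K P).
  apply: (@add_dsum K _ P (pull f (spread_rep K S)) (pull f (spreads K Ss))); last first.
    by apply: IH => S' S'in; apply: sp; rewrite inE S'in orbT.
  have [|_ [cS _]] := sp S; first by rewrite mem_head.
  apply: (@add_ind K _ P (fun x => f x \in S)) => a x b aS bS ax xb.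
  by apply: (cS (f a) _ (f b)) => //; apply: mf.
apply: add_retract aS.
  by split=> [x|x y z xy yz] /=; [apply: Z1|apply: Z2; apply: mf].
exists (pullf f s), (pullf f r); split; [|split].
- by move=> x y /mf; apply: ns.
- by move=> x y /mf; apply: nr.
by move=> x; apply: sr.
Qed.

Variables (d d' : Order.disp_t) (P : finPOrderType d) (P' : finPOrderType d').
Variables (f : P -> P') (r : P' -> P).
Hypothesis adj : forall x y, (f x <= y)%O = (x <= r y)%O.

Lemma adj_unit x : (x <= r (f x))%O. Proof. by rewrite -adj. Qed.
Lemma adj_counit y : (f (r y) <= y)%O. Proof. by rewrite adj. Qed.
Lemma adj_homoL x y : (x <= y)%O -> (f x <= f y)%O.
Proof. by move=> xy; rewrite adj (le_trans xy (adj_unit y)). Qed.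
Lemma adj_homoR x y : (x <= y)%O -> (r x <= r y)%O.
Proof. by move=> xy; rewrite -adj (le_trans (adj_counit x) xy). Qed.

(** As [f] is left adjoint to [r], the functor [pull r] is left adjoint to [pull f]; this and
    [untranspose] are the two directions of that adjunction. *)
Definition transpose Z N (h : homf Z (pull f N)) : homf (pull r Z) N :=
  fun y => h (r y) *m rmap N (f (r y)) y.

Definition untranspose Z N (w : homf (pull r Z) N) : homf Z (pull f N) :=
  fun x => rmap Z x (r (f x)) *m w (f x).

Lemma transpose_natural Z N (h : homf Z (pull f N)) :
  is_rep N -> natural h -> natural (transpose h).
Proof.
move=> [N1 N2] nh y y' yy'; rewrite /transpose /= mulmxA.
have e := nh _ _ (adj_homoR yy'); rewrite /= in e; rewrite e -!mulmxA; congr (_ *m _).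
rewrite -(N2 (f (r y)) y y') ?adj_counit // -N2 ?adj_counit //.
exact/adj_homoL/adj_homoR.
Qed.

Lemma untranspose_natural Z N (w : homf (pull r Z) N) :
  is_rep Z -> natural w -> natural (untranspose w).
Proof.
move=> [Z1 Z2] nw x x' xx'; rewrite /untranspose mulmxA -Z2 ?adj_unit //.
rewrite (Z2 x (r (f x))) ?adj_unit //; last exact/adj_homoR/adj_homoL.
have e := nw _ _ (adj_homoL xx'); rewrite /= in e.
by rewrite -[LHS]mulmxA e mulmxA.
Qed.

Lemma transposeK Z N (h : homf Z (pull f N)) x : is_rep N -> natural h ->
  rmap Z x (r (f x)) *m transpose h (f x) = h x.
Proof.
move=> [N1 N2] nh; rewrite /transpose mulmxA.
rewrite (nh _ _ (adj_unit x)) /= -mulmxA -N2 ?adj_counit ?N1 ?mulmx1 //.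
exact/adj_homoL/adj_unit.
Qed.

Lemma pull_lifts Z B C (g : homf B C) (h : homf Z (pull f C)) :
  is_rep Z -> is_rep C -> natural h -> lifts g (transpose h) -> lifts (pullf f g) h.
Proof.
move=> rZ rC nh [w [nw wg]]; exists (untranspose w); split; first exact: untranspose_natural.
by move=> x; rewrite /untranspose /pullf -mulmxA wg transposeK.
Qed.

(** Transposition turns a test object [Z] into [pull r Z], again in add spread, where [g] solves the
    lifting problem. *)
Lemma pull_approx C M (g : homf C M) : is_rep M -> approx g -> approx (pullf f g).
Proof.
move=> rM ag Z h aZ nh; apply: (pull_lifts (add_is_rep aZ) rM nh).
apply: ag; last exact: transpose_natural.
by apply: pull_add aZ; apply: adj_homoR.
Qed.

Lemma pull_dimle n M : is_rep M -> dimle n M -> dimle n (pull f M).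
Proof.
elim: n M => [|n IH] M rM; first exact: (pull_add adj_homoL).
move=> [C [g [L [k [[aC ng ag] [nk kk dL]]]]]].
exists (pull f C), (pullf f g), (pull f L), (pullf f k); split; split.
- exact: (pull_add adj_homoL).
- by move=> x y /adj_homoL; apply: ng.
- exact: pull_approx.
- by move=> x y /adj_homoL; apply: nk.
- by move=> x; apply: kk.
by apply: IH => //; apply: sub_is_rep kk (add_is_rep aC).
Qed.

End Pullback.

(** * Transfer of almost split maps along the adjunction *)

Lemma connected_extension d (P : finPOrderType d) (V S : {set P}) :
  connected_set V -> S != set0 -> S \subset V -> V <> S ->
  (forall z s, s \in S -> z \in V -> (z <= s)%O -> z \in S) ->
  exists z s, [/\ z \in V, z \notin S, s \in S & (s <= z)%O].
Proof.
move=> cV /set0Pn[s0 s0S] SV VS down; apply: NNPP => none; apply: VS.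
apply/eqP; rewrite eqEsubset SV andbT; apply/subsetP => z zV.
have cl : closed (spread_rel V) S.
  apply: intro_closed; first exact: spread_rel_sym.
  move=> a b /and3P[aV bV ab] aS; case/orP: ab => ab; last exact: down ab.
  by apply/negPn/negP => bS; apply: none; exists b, a.
by rewrite -(closed_connect cl (cV s0 z (subsetP SV _ s0S) zV)).
Qed.

Lemma minimal_element d (P : finPOrderType d) (p : pred P) z0 : p z0 ->
  exists m, p m /\ forall z, p z -> (z <= m)%O -> z = m.
Proof.
move=> pz0; case: (arg_minnP (fun z : P => #|[set w | (w <= z)%O]|) pz0) => m pm mm.
exists m; split=> // z pz zm.
have sub : [set w | (w <= z)%O] \subset [set w | (w <= m)%O].
  by apply/subsetP => w; rewrite !inE => wz; apply: le_trans zm.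
have /eqP e : [set w | (w <= z)%O] == [set w | (w <= m)%O].
  by rewrite eqEcard sub mm.
have : m \in [set w | (w <= z)%O] by rewrite e inE.
by rewrite inE => mz; apply: le_anti; rewrite zm.
Qed.

Section SimplePullback.
Local Open Scope ring_scope.
Variables (K : fieldType) (d d' : Order.disp_t) (P : finPOrderType d) (P' : finPOrderType d').
Variables (f : P -> P') (r : P' -> P).
Hypothesis adj : forall x y, (f x <= y)%O = (x <= r y)%O.
Variable S : {set P}.
Hypothesis S_spread : is_spread S.
Hypothesis S_saturated : forall x, (r (f x) \in S) = (x \in S).
Local Notation spr S := (spread_rep K S).

Let S' : {set P'} := [set y | r y \in S].

Lemma saturated_mem x : (f x \in S') = (x \in S). Proof. by rewrite inE S_saturated. Qed.

(** The map [f] carries zigzags of [S] into [S'], and each [y] in [S'] lies above [f (r y)], which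
    is in [S'] as well. *)
Lemma saturated_spread : is_spread S'.
Proof.
have [/set0Pn[x xS] [cS nS]] := S_spread; split.
  by apply/set0Pn; exists (f x); rewrite saturated_mem.
split.
  move=> s y s'; rewrite !inE => sS s'S sy ys'.
  by apply: (cS _ _ _ sS s'S); apply: (adj_homoR adj).
have base a b : a \in S -> b \in S -> connect (spread_rel S') (f a) (f b).
  move=> aS bS.
  have cl : closed (spread_rel S) [pred z | connect (spread_rel S') (f a) (f z)].
    apply: intro_closed; first exact: spread_rel_sym.
    move=> u v /and3P[uS vS uv]; rewrite !inE => au; apply: connect_trans au _.
    apply: connect1; rewrite /spread_rel !saturated_mem uS vS /=.
    by case/orP: uv => /(adj_homoL adj)->; rewrite ?orbT.
  by have := closed_connect cl (nS a b aS bS); rewrite !inE connect0 => <-.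
have ret y : y \in S' -> connect (spread_rel S') (f (r y)) y.
  move=> yS; have rS : r y \in S by move: yS; rewrite inE.
  apply: connect1; rewrite /spread_rel saturated_mem.
  by rewrite rS yS (adj_counit adj).
move=> y z yS zS; apply: connect_trans (ret z zS).
rewrite spread_rel_sym; apply: connect_trans (ret y yS).
by apply: base; [move: zS|move: yS]; rewrite inE.
Qed.

(** The points with [r (f x) = x] form the image of [r], so they are those that [pull r] sees.
    [S_lower] serves to force [S] into a larger spread, [S_upper] to detect where that spread leaves
    [S]. *)
Hypothesis S_lower : forall x, x \in S -> exists x0, [/\ x0 \in S, (x0 <= x)%O & r (f x0) = x0].
Hypothesis S_upper : forall (X : {set P}) m, convex X -> S \subset X -> m \in X -> m \notin S ->
  (exists2 s, s \in S & (s <= m)%O) ->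
  (forall z, z \in X -> z \notin S -> (exists2 s, s \in S & (s <= z)%O) -> (z <= m)%O -> z = m) ->
  r (f m) = m.

Let mS x := x \in S.
Let mS' y := y \in S'.
Let mfS x := f x \in S'.
Let mrS y := r y \in S.

Let to_S : homf (pull f (spr S')) (spr S) := indf mfS mS (fun _ => 1).
Let of_S : homf (spr S) (pull f (spr S')) := indf mS mfS (fun _ => 1).
Let to_pull : homf (spr S') (pull r (spr S)) := indf mS' mrS (fun _ => 1).
Let of_pull : homf (pull r (spr S)) (spr S') := indf mrS mS' (fun _ => 1).

(** Transposing a map from [spr V] to [spr S] gives a lifting problem for [rho], solvable unless
    some composite of [spr S'] through [pull r (spr V)] is nonzero. Then [S] would be down-closed in
    [V], and a minimal point [m] of [V] above [S] would be visible to [pull r]; naturality would put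
    [f m] in [S'], hence [m] in [S]. *)
Lemma simple_pull n : (forall S0 : {set P'}, is_spread S0 -> simple_le K n S0) -> simple_le K n S.
Proof.
move=> simp; have sS' := saturated_spread.
have [C [rho [L [k [[aC nrho rsplit rnull] [nk kk dL]]]]]] := simp S' sS'.
have efS : mfS =1 mS by move=> x; rewrite /mfS /mS saturated_mem.
have erS : mS' =1 mrS by move=> x; rewrite /mS' /mrS inE.
have [nto to_of] := @ind_iso K _ _ _ _ efS; have [nof of_to] := @ind_iso K _ _ _ _ (fsym efS).
have [ntp tp_op] := @ind_iso K _ _ _ _ erS; have [nop op_tp] := @ind_iso K _ _ _ _ (fsym erS).
rewrite -/to_S -/of_S in nto to_of nof of_to; rewrite -/to_pull -/of_pull in ntp tp_op nop op_tp.
have [[Sne [cS nS]] [S'ne [cS' nS']]] := (S_spread, sS').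
have rS' : is_rep (spr S') by apply/add_is_rep/add_spread.
have aC' : in_add_spread (pull f C) by apply: pull_add aC; apply: adj_homoL adj.
have rC : is_rep C by apply: add_is_rep.
exists (pull f C), (compf (pullf f rho) to_S), (pull f L), (pullf f k).
split; last first.
  split.
  - by move=> x y /(adj_homoL adj); apply: nk.
  - apply: is_kerI => x.
    + by move=> m v v0; apply: (ker_inj (x := f x) kk); rewrite mul0mx.
    + by rewrite /compf mulmxA [X in X *m _](ker_comp (f x) kk) mul0mx.
    move=> m v v0; apply: (ker_ex (x := f x) kk).
    have := congr1 (mulmx^~ (of_S x)) v0; rewrite /= /compf mul0mx -!mulmxA.
    by rewrite to_of mulmx1.
  by apply: (pull_dimle adj) dL; apply: sub_is_rep kk rC.
split=> //.
- by apply: natural_comp => // x y /(adj_homoL adj); apply: nrho.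
- move=> V u sV VS nu; have [Vne [cV nV]] := sV.
  have aV := add_spread K sV; have rV := add_is_rep aV.
  pose v : homf (spr V) (pull f (spr S')) := compf u of_S.
  have nv : natural v by apply: natural_comp.
  have ntv : natural (transpose r v) by apply: (transpose_natural adj).
  have aVr : in_add_spread (pull r (spr V)) by apply: pull_add aV; apply: adj_homoR adj.
  suff /(pull_lifts adj rV rS' nv)[w [nw wE]] : lifts rho (transpose r v).
    exists w; split=> // x; rewrite /compf mulmxA wE /v /compf -mulmxA of_to mulmx1 //.
  apply: (add_lifts aVr ntv) => W a sW na.
  have [WS|WS] := classic (W = S'); last exact/rsplit/natural_comp.
  subst W; apply: (lifts_ext _ (lifts_null _ rho)) => y0; apply/esym/eqP.
  pose mV x := x \in V; pose mrV y := r y \in V.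
  rewrite -(@ev_eq0 _ _ _ mS' mS' (compf a (transpose r v))).
  apply/negPn/negP => e0.
  have [y0S _] := @ev_neq0 _ _ _ mS' mS' (compf a (transpose r v)) y0 e0.
  have ne y : y \in S' -> ev a y != 0 /\ ev (transpose r v) y != 0.
    move=> yS; apply/andP; rewrite -negb_or -mulf_eq0 -(@ev_comp _ _ _ mS' mrV mS').
    by rewrite -(@ev_connected _ _ _ S' mS' (compf a (transpose r v)) nS' (natural_comp na ntv) (fun _ => id) y0).
  have S'V y : y \in S' -> r y \in V.
    by move=> /ne[a0 _]; case: (@ev_neq0 _ _ _ mS' mrV a y a0).
  have up y z : y \in S' -> r z \in V -> (y <= z)%O -> z \in S'.
    move=> yS zV yz; have [a0 _] := ne y yS.
    rewrite (@ev_natural _ _ _ mS' mrV a y z na yz yS zV) in a0.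
    by case: (@ev_neq0 _ _ _ mS' mrV a z a0).
  (* Each [x] lies between [x0] and [r (f x)], both images under [r] of points of [S']. *)
  have SV : S \subset V.
    apply/subsetP => x xS; have [x0 [x0S x0x rx0]] := S_lower xS.
    apply: (cV x0 _ (r (f x))) => //; last exact: adj_unit adj x.
      by rewrite -rx0; apply: S'V; rewrite saturated_mem.
    by apply: S'V; rewrite saturated_mem.
  have u0 x : x \in S -> ev u x != 0.
    move=> xS; have xS' : f x \in S' by rewrite saturated_mem.
    have xV := subsetP SV _ xS.
    have rxS : r (f x) \in S by rewrite S_saturated.
    rewrite (@ev_natural _ _ _ mV mS u x (r (f x)) nu (adj_unit adj x) xV rxS).
    rewrite (@ev_eq0 _ _ _ mV mS); apply/eqP => ur.
    have [_ /negP] := ne _ xS'; apply; rewrite (@ev_eq0 _ _ _ mrV mS' (transpose r v)).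
    by rewrite /transpose /v /compf ur !mul0mx.
  have down z s : s \in S -> z \in V -> (z <= s)%O -> z \in S.
    move=> sS zV zs; have := u0 s sS; rewrite -(@ev_natural _ _ _ mV mS u z s nu zs zV sS).
    by move/(@ev_neq0 _ _ _ mV mS) => [].
  have [z0 [s0 [z0V z0S s0S s0z0]]] := connected_extension nV Sne SV VS down.
  pose bad z := [&& z \in V, z \notin S & [exists s in S, (s <= z)%O]].
  have [|m [/and3P[mV' mS0 /exists_inP[s sS sm]] mm]] := @minimal_element _ P bad z0.
    by rewrite /bad z0V z0S; apply/exists_inP; exists s0.
  have rm : r (f m) = m.
    apply: (S_upper cV SV mV' mS0); first by exists s.
    by move=> z zV zS [t tS tz]; apply: mm; rewrite /bad zV zS; apply/exists_inP; exists t.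
  have : f m \in S'.
    apply: (up (f s)); first by rewrite saturated_mem.
      by rewrite rm.
    exact: adj_homoL adj _ _ sm.
  by rewrite saturated_mem (negbTE mS0).
move=> u nu x.
have rS : is_rep (spr S) by apply/add_is_rep/add_spread.
have ntu : natural (transpose r u) by apply: (transpose_natural adj).
(* [pull r (spr S)] is isomorphic to [spr S'], so the last clause for [rho] applies to the
   transpose. *)
have z y : transpose r u y *m rho y = 0.
  have := rnull (compf to_pull (transpose r u)) (natural_comp ntp ntu) y.
  move/(congr1 (mulmx (of_pull y))); rewrite /compf !mulmxA op_tp mul1mx => ->.
  by rewrite mulmx0.
rewrite /compf /pullf mulmxA -(transposeK adj x rC nu) -[X in X *m _]mulmxA z.
by rewrite mulmx0 mul0mx.
Qed.

End SimplePullback.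

(** * Products with a chain *)

Section ChainBlocks.
Local Open Scope order_scope.
Variables (d : Order.disp_t) (T : finOrderType d).
Implicit Types (s t u : T) (p : pred T).

Lemma fin_max p t : p t -> exists m, p m /\ forall u, p u -> u <= m.
Proof.
by move=> pt; case: (@arg_maxP _ T T t p id pt) => m pm mm; exists m.
Qed.

Lemma fin_min p t : p t -> exists m, p m /\ forall u, p u -> m <= u.
Proof.
by move=> pt; case: (@arg_minP _ T T t p id pt) => m pm mm; exists m.
Qed.

Lemma pick_unique t0 p t : p t -> (forall u, p u -> u = t) -> odflt t0 [pick u | p u] = t.
Proof. by move=> pt uniq; case: pickP => [u /uniq//|/(_ t)]; rewrite pt. Qed.

(* The blocks are cut after each element of [E]: [phi] numbers them and [psi] returns
   their last elements. *)
Lemma block_maps t0 (E : {set T}) n : (#|E| <= n)%N ->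
  exists (phi : T -> 'I_(1 + n)) (psi : 'I_(1 + n) -> T),
    (forall t y, (phi t <= y) = (t <= psi y)) /\
    (forall t e, e \in E -> t <= e -> psi (phi t) <= e).
Proof.
(* Counting strictly below [t] makes each cut point the last of its block; the counts range from 0
   to at most [n], whence [1 + n] block numbers. *)
move=> En; pose c t := #|[set e in E | e < t]|.
have cn t : (c t < n.+1)%N.
  rewrite ltnS; apply: leq_trans En; apply: subset_leq_card.
  by apply/subsetP => e; rewrite inE => /andP[].
pose phi t : 'I_(1 + n) := Ordinal (cn t).
have c_le s t : s <= t -> (c s <= c t)%N.
  move=> st; apply: subset_leq_card; apply/subsetP => e; rewrite !inE => /andP[-> es].
  exact: lt_le_trans es st.
have [t1 [_ t1min]] := @fin_min predT t0 isT.
have ct1 : c t1 = 0%N.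
  by apply: eq_card0 => e; rewrite !inE ltNge t1min // andbF.
have [psi psiP] : exists psi : 'I_(1 + n) -> T, forall y, forall t, (phi t <= y) = (t <= psi y).
  apply: (@fin_all_exists _ _ (fun y s => forall t, (phi t <= y) = (t <= s))) => y.
  have [|m [my mmax]] := @fin_max (fun t => phi t <= y) t1.
    by rewrite leEord /= ct1.
  exists m => t; apply/idP/idP => [/mmax//|tm].
  by apply: le_trans my; rewrite leEord /=; apply: c_le.
exists phi, psi; split=> // t e eE te; rewrite leNgt; apply/negP => es.
have : (c (psi (phi t)) <= c t)%N by have := psiP (phi t) (psi (phi t)); rewrite lexx leEord.
apply/negP; rewrite -ltnNge; apply: proper_card; rewrite properE; apply/andP; split.
  apply/subsetP => u; rewrite !inE => /andP[-> ut] /=.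
  exact: lt_trans (lt_le_trans ut te) es.
by apply/subsetPn; exists e; rewrite !inE eE //= ltNge te.
Qed.

Variables (dQ : Order.disp_t) (Q : finPOrderType dQ).
Implicit Types q : Q.
Variable S : {set T * Q}.
Hypothesis S_convex : convex S.

Definition slice_first q t := ((t, q) \in S) && [forall u, (u < t) ==> ((u, q) \notin S)].
Definition slice_last q t := ((t, q) \in S) && [forall u, (t < u) ==> ((u, q) \notin S)].
(** Cutting at this predecessor makes a block start at the first element of the slice, so no block
    enters the slice midway. *)
Definition before_first q t :=
  [exists a, [&& slice_first q a, t < a & [forall u, (u < a) ==> (u <= t)]]].
Definition after_last q t :=
  [exists b, [&& slice_last q b, b < t & [forall u, (b < u) ==> (t <= u)]]].

Lemma le_pair (x y : T * Q) : (x <= y) = (x.1 <= y.1) && (x.2 <= y.2).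
Proof. by []. Qed.

Lemma slice_convex t u w q : (t, q) \in S -> (w, q) \in S -> t <= u -> u <= w -> (u, q) \in S.
Proof. by move=> tS wS tu uw; apply: (S_convex tS wS); rewrite le_pair /= ?tu ?uw lexx. Qed.

Lemma slice_firstP q t : slice_first q t -> (t, q) \in S /\ forall u, (u, q) \in S -> t <= u.
Proof.
case/andP => tS /forallP tm; split=> // u uS; rewrite leNgt; apply/negP => ut.
by have /implyP/(_ ut) := tm u; rewrite uS.
Qed.

Lemma slice_lastP q t : slice_last q t -> (t, q) \in S /\ forall u, (u, q) \in S -> u <= t.
Proof.
case/andP => tS /forallP tm; split=> // u uS; rewrite leNgt; apply/negP => ut.
by have /implyP/(_ ut) := tm u; rewrite uS.
Qed.

Lemma slice_first_ex q t : (t, q) \in S -> exists a, slice_first q a.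
Proof.
move=> tS; have [a [aS am]] := @fin_min (fun u => (u, q) \in S) t tS.
exists a; rewrite /slice_first aS; apply/forallP => u; apply/implyP => ua.
by apply/negP => /am; rewrite leNgt ua.
Qed.

Lemma slice_last_ex q t : (t, q) \in S -> exists b, slice_last q b.
Proof.
move=> tS; have [b [bS bm]] := @fin_max (fun u => (u, q) \in S) t tS.
exists b; rewrite /slice_last bS; apply/forallP => u; apply/implyP => bu.
by apply/negP => /bm; rewrite leNgt bu.
Qed.

Lemma slice_first_uniq q t u : slice_first q t -> slice_first q u -> u = t.
Proof.
move=> /slice_firstP[tS tm] /slice_firstP[uS um].
by apply: le_anti; rewrite um // tm.
Qed.

Lemma slice_last_uniq q t u : slice_last q t -> slice_last q u -> u = t.
Proof.
move=> /slice_lastP[tS tm] /slice_lastP[uS um].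
by apply: le_anti; rewrite um // tm.
Qed.

Lemma before_first_uniq q t u : before_first q t -> before_first q u -> u = t.
Proof.
case/existsP => a /and3P[fa ta /forallP tm] /existsP[b /and3P[fb ub /forallP um]].
have e := slice_first_uniq fa fb; subst b.
by apply: le_anti; rewrite (implyP (tm u)) // (implyP (um t)).
Qed.

Lemma after_last_uniq q t u : after_last q t -> after_last q u -> u = t.
Proof.
case/existsP => a /and3P[fa ta /forallP tm] /existsP[b /and3P[fb ub /forallP um]].
have e := slice_last_uniq fa fb; subst b.
by apply: le_anti; rewrite (implyP (tm u)) // (implyP (um t)).
Qed.

Definition is_mark t := exists q,
  [\/ slice_first q t, slice_last q t, before_first q t | after_last q t].

(** Each of the four kinds occurs at most once for a given [q]. Where a kind is absent, [t0] stands
    in; an extra cut is harmless. *)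
Lemma mark_set t0 : exists E : {set T}, (#|E| <= 4 * #|Q|)%N /\ forall t, is_mark t -> t \in E.
Proof.
pose pk p := odflt t0 [pick u | p u].
pose h (x : Q * 'I_4) := nth t0 [:: pk (slice_first x.1); pk (slice_last x.1);
   pk (before_first x.1); pk (after_last x.1)] x.2.
exists [set h x | x in predT]; split.
  by apply: leq_trans (leq_imset_card _ _) _; rewrite card_prod card_ord mulnC.
move=> t [q tq]; have [j tE] : exists j : 'I_4, t = h (q, j).
  case: tq => tq.
  - by exists (@Ordinal 4 0 isT); rewrite /h /= /pk (pick_unique _ tq (fun u => slice_first_uniq tq)).
  - by exists (@Ordinal 4 1 isT); rewrite /h /= /pk (pick_unique _ tq (fun u => slice_last_uniq tq)).
  - by exists (@Ordinal 4 2 isT); rewrite /h /= /pk (pick_unique _ tq (fun u => before_first_uniq tq)).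
  by exists (@Ordinal 4 3 isT); rewrite /h /= /pk (pick_unique _ tq (fun u => after_last_uniq tq)).
by rewrite tE imset_f.
Qed.

(** Step down the chain at fixed [q]. If the predecessor of [t] is still above an element of [S],
    minimality puts it in [S], and [t] follows the last element of its slice. Otherwise the element
    of [S] below has first coordinate [t], and [t] is the first element of the slice at [q']. *)
Lemma minimal_extension_mark (X : {set T * Q}) t q : convex X -> S \subset X ->
  (t, q) \in X -> (t, q) \notin S -> (exists2 s, s \in S & s <= (t, q)) ->
  (forall z, z \in X -> z \notin S -> (exists2 s, s \in S & s <= z) -> z <= (t, q) -> z = (t, q)) ->
  is_mark t.
Proof.
move=> cX SX tX tS [[t' q'] sS]; rewrite le_pair /= => /andP[t't q'q] mint.
have [[u [ut [s s'S su]]]|none] := classic (exists u, u < t /\ exists2 s, s \in S & s <= (u, q)).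
  have [w [wt wm]] := @fin_max (fun u => u < t) u ut.
  have sw : s <= (w, q) by apply: le_trans su _; rewrite le_pair /= wm ?lexx.
  have wX : (w, q) \in X.
    by apply: (cX s _ (t, q)) => //; [apply: (subsetP SX)|rewrite le_pair /= ltW ?lexx].
  have wS : (w, q) \in S.
    apply/negPn/negP => wS; have e : (w, q) = (t, q).
      by apply: (mint _ wX wS); [exists s|rewrite le_pair /= ltW ?lexx].
    by case: e => e; rewrite e ltxx in wt.
  exists q; constructor 4; apply/existsP; exists w; rewrite wt /=.
  have tm u' : w < u' -> t <= u' by move=> wu'; rewrite leNgt; apply/negP => /wm; rewrite leNgt wu'.
  apply/andP; split; last by apply/forallP => u'; apply/implyP/tm.
  rewrite /slice_last wS; apply/forallP => u'; apply/implyP => wu'; apply/negP => u'S.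
  by move/negP: tS; apply; apply: (slice_convex wS u'S (ltW wt) (tm _ wu')).
have e : t' = t.
  apply: le_anti; rewrite t't leNgt; apply/negP => lt.
  by apply: none; exists t'; split=> //; exists (t', q'); rewrite // le_pair /= lexx.
subst t'; exists q'; constructor 1; rewrite /slice_first sS.
apply/forallP => u; apply/implyP => ut; apply/negP => uS; apply: none.
by exists u; split=> //; exists (u, q'); rewrite // le_pair /= lexx.
Qed.

End ChainBlocks.

(** * Reduction to a chain of bounded length, and the theorem *)

Lemma simple_product (K : fieldType) d (T : finOrderType d) dQ (Q : finPOrderType dQ)
    (S : {set T * Q}) n :
  (forall S0 : {set 'I_(1 + 4 * #|Q|) * Q}, is_spread S0 -> simple_le K n S0) ->
  is_spread S -> simple_le K n S.
Proof.
move=> simp sS; have [/set0Pn[[t0 q0] _] [cS _]] := sS.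
have [E [En markE]] := mark_set S t0.
have [phi [psi [adj blk]]] := block_maps t0 En.
pose f (x : T * Q) : 'I_(1 + 4 * #|Q|) * Q := (phi x.1, x.2).
pose r (y : 'I_(1 + 4 * #|Q|) * Q) : T * Q := (psi y.1, y.2).
have mark_top t : is_mark S t -> psi (phi t) = t.
  move/markE => tE; apply: le_anti; rewrite blk //=.
  by rewrite -adj lexx.
have unit t : (t <= psi (phi t))%O by rewrite -adj.
(* A point outside the slice whose block ends inside it would precede the first element, but the
   mark before that element ends the block earlier. Conversely, the last element of the slice is a
   mark, so no block runs past it. *)
have sat (x : T * Q) : (r (f x) \in S) = (x \in S).
  case: x => t q; rewrite /r /f /=; apply/idP/idP => tS.
    apply/negPn/negP => nS; have [a fa] := slice_first_ex tS.
    have [aS am] := slice_firstP fa.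
    have ta : (t < a)%O.
      rewrite ltNge; apply/negP => at_; move/negP: nS; apply.
      exact: (slice_convex cS aS tS at_ (unit t)).
    have [e [ea em]] := @fin_max _ _ (fun u => (u < a)%O) t ta.
    have eE : e \in E.
      apply: markE; exists q; constructor 3; apply/existsP; exists a; rewrite fa ea /=.
      by apply/forallP => u; apply/implyP/em.
    have := am _ tS; apply/negP; rewrite -ltNge; apply: le_lt_trans ea.
    exact: blk eE (em _ ta).
  have [b lb] := slice_last_ex tS; have [bS bm] := slice_lastP lb.
  apply: (slice_convex cS tS bS (unit t)); apply: blk (bm _ tS).
  by apply: markE; exists q; constructor 2.
apply: (@simple_pull K _ _ _ _ f r) => //.
- by case=> [t q] [y q']; rewrite /f /r /= !leEprod /= adj.
- case=> t q tS; have [a fa] := slice_first_ex tS; have [aS am] := slice_firstP fa.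
  exists (a, q); split=> //; first by rewrite le_pair /= am //=.
  by rewrite /r /f /= mark_top //; exists q; constructor 1.
move=> X [t q] cX SX tX tS ex mint; rewrite /r /f /= mark_top //.
exact: (minimal_extension_mark cS cX SX tX tS ex mint).
Qed.

Lemma gldim_simples (K : fieldType) d (P : finPOrderType d) n :
  gldim_spread_le K P n <-> forall S : {set P}, is_spread S -> simple_le K n S.
Proof.
split=> [gl S sS|simp M rM].
  have [C [rho as_]] := almost_split_exists K sS; case: (as_) => aC nrho _ _.
  have nk := ker_inc_natural nrho; have kk := ker_inc_is_ker rho.
  have rL : is_rep (ker_rep rho) by apply: sub_is_rep kk (add_is_rep aC).
  exists C, rho, (ker_rep rho), (ker_inc rho); split=> //; split=> //.
  exact/spread_dim_dimle/gl.
have [R [rR zR]] := dimle_resolution (dimle_simples simp rM).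
by exists R; split=> //; exists n.
Qed.

Theorem theoremC (K : fieldType) :
  (forall (dQ : Order.disp_t) (Q : finPOrderType dQ),
     exists N : nat,
       forall (dT : Order.disp_t) (T : finOrderType dT),
         gldim_spread_le K (T * Q)%type N) /\
  (forall (dG : Order.disp_t) (G : finPOrderType dG),
     is_grid G ->
     forall n : nat,
       (forall (dT : Order.disp_t) (T : finOrderType dT),
          gldim_spread_le K (T * G)%type n) <->
       gldim_spread_le K ('I_(1 + 4 * #|G|) * G)%type n).
Proof.
split=> [dQ Q|dG G _ n].
  (* The bound for this one poset serves every [T]. *)
  have [N simp] := @simples_bounded K _ ('I_(1 + 4 * #|Q|) * Q)%type.
  exists N => dT T; apply/gldim_simples => S; exact: simple_product.
(* The ordinal is itself one of the chains [T]. *)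
split=> [gl|/gldim_simples simp dT T]; first exact: gl.
by apply/gldim_simples => S; apply: simple_product.
Qed.
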